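(* Let $d\ge2$ and $\alpha\in(0,d)$. For every $0<r<1$ and every $M \in \mathbb{N}$, there exists $u \in BV(\mathbb{R}^d)$ such that $$\|I_\alpha Du \|_{L^{d/(d-\alpha),r}(\mathbb{R}^d;\mathbb{R}^d)} >M\, |D u|(\mathbb{R}^d).$$
   Context: $BV(\mathbb{R}^d)$ is the space of (real-valued) functions of bounded variation on $\mathbb{R}^d$; $Du$ is the distributional gradient (a finite $\mathbb{R}^d$-valued Radon measure) and $|Du|(\mathbb{R}^d)$ its total variation. Riesz potential: for $\alpha\in(0,d)$ and a finite vector measure (or $L^1$ function) $F$, $$I_\alpha F(x)=\frac{1}{\Gamma(\alpha/2)}\int_0^\infty t^{\alpha/2-1}\,p_t*F(x)\,dt,\qquad p_t(x)=(4\pi t)^{-d/2}\exp(-|x|^2/4t).$$ Lorentz spaces: for $1<p<\infty$, $0<q<\infty$, $\|u\|_{L^{p,q}(\mathbb{R}^d)}^q=p\int_0^\infty\big(t\,|\{|u|>t\}|^{1/p}\big)^q\frac{dt}{t}$ (with $|u|$ the Euclidean norm for vector-valued $u$; the value $+\infty$ is allowed). *)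

(* Defs.v *)
From HB Require Import structures.
From mathcomp Require Import all_boot all_order all_algebra.
From mathcomp Require Import all_classical all_reals all_analysis.

Set Implicit Arguments.
Unset Strict Implicit.
Unset Printing Implicit Defensive.

Import Order.TTheory GRing.Theory Num.Theory.
Import numFieldNormedType.Exports.

Local Open Scope classical_set_scope.
Local Open Scope ring_scope.

(* R^n is 'rV[R]_n. The library norm on 'rV[R]_n is the sup norm: it is used
   only for its topology, Euclidean lengths are always written enorm. *)

(* The sigma-algebra on 'rV[R]_n is the product sigma-algebra, generated by the
   coordinate maps; it coincides with the Borel sigma-algebra. *)

Definition measure_rV_display : measure_display.
Proof. exact: default_measure_display. Qed.

Section measurable_rV.
Context {R : realType}.
Variable n : nat.

Let coors : 'I_n -> 'rV[R]_n -> measurableTypeR R := fun i x => x ord0 i.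

Let rV_set0 : g_sigma_preimage coors set0.
Proof. exact: sigma_algebra0. Qed.

Let rV_setC A : g_sigma_preimage coors A -> g_sigma_preimage coors (~` A).
Proof. exact: sigma_algebraC. Qed.

Let rV_bigcup (F : _^nat) : (forall i, g_sigma_preimage coors (F i)) ->
  g_sigma_preimage coors (\bigcup_i (F i)).
Proof. exact: sigma_algebra_bigcup. Qed.

HB.instance Definition _ := @isMeasurable.Build measure_rV_display
  'rV[R]_n (g_sigma_preimage coors) rV_set0 rV_setC rV_bigcup.

End measurable_rV.

Definition rV_cons (R : realType) n (p : measurableTypeR R * 'rV[R]_n) :
  'rV[R]_n.+1 := row_mx (p.1%:M : 'rV_1) p.2.

Lemma measurable_coord (R : realType) n (i : 'I_n) :
  measurable_fun [set: 'rV[R]_n]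
    (fun x : 'rV[R]_n => x ord0 i : measurableTypeR R).
Proof.
move=> _ Y mY; rewrite setTI; apply: sub_sigma_algebra => /=.
rewrite -bigcup_seq/=; exists i => /=; first by rewrite mem_index_enum.
by exists Y => //; rewrite setTI.
Qed.

Lemma rV_cons0 (R : realType) n p : @rV_cons R n p ord0 ord0 = p.1.
Proof.
by rewrite /rV_cons mxE; case: splitP => // k _; rewrite (ord1 k) mxE eqxx.
Qed.

Lemma rV_consS (R : realType) n p (j : 'I_n) :
  @rV_cons R n p ord0 (lift ord0 j) = p.2 ord0 j.
Proof.
rewrite /rV_cons mxE; case: splitP => k; first by rewrite (ord1 k).
by move=> /eqP; rewrite lift0 eqSS => /eqP/val_inj ->.
Qed.

Lemma measurable_fun_rV d (T : measurableType d) (R : realType) n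
    (f : T -> 'rV[R]_n) :
  (forall i, measurable_fun [set: T]
     (fun x => f x ord0 i : measurableTypeR R)) ->
  measurable_fun [set: T] f.
Proof.
move=> mf; apply: (@measurability _ _ _ _ _ _
  (\big[setU/set0]_(i < n) preimage_set_system setT
     (fun x : 'rV[R]_n => x ord0 i : measurableTypeR R) measurable)) => //.
move=> A [B + <-]; rewrite -bigcup_seq => -[i _ [Y mY <-]].
by rewrite !setTI -comp_preimage -[X in measurable X]setTI; exact: mf.
Qed.

Lemma measurable_rV_cons (R : realType) n :
  measurable_fun [set: measurableTypeR R * 'rV[R]_n] (@rV_cons R n).
Proof.
apply: measurable_fun_rV => i; have [j ->|->] := unliftP ord0 i.
- under eq_fun do rewrite rV_consS.
  exact: (measurableT_comp (@measurable_coord R n j) measurable_snd).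
- under eq_fun do rewrite rV_cons0.
  exact: measurable_fst.
Qed.

Section lebesgue_rV_step.
Local Open Scope ereal_scope.
Context {R : realType} (n : nat).
Variable mu : {sigma_finite_measure set 'rV[R]_n -> \bar R}.

Definition lebesgue_rV_step : set 'rV[R]_n.+1 -> \bar R :=
  pushforward (@lebesgue_measure R \x mu) (@rV_cons R n).

HB.instance Definition _ := Measure.copy lebesgue_rV_step
  (measure_function_pushforward__canonical__measure_function_Measure
     (@lebesgue_measure R \x mu) (@measurable_rV_cons R n)).

Let sigma_finite_step : sigma_finite setT lebesgue_rV_step.
Proof.
have [H TH mH] : sigma_finite setT (@lebesgue_measure R \x mu).
  have /sigma_finiteP[F [TF ndF Foo]] := sigma_finiteT (@lebesgue_measure R).
  have /sigma_finiteP[G [TG ndG Goo]] := sigma_finiteT mu.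
  exists (fun k => F k `*` G k).
    rewrite -setXTT TF TG predeqE => -[x y]; split.
      move=> [/= [k _ Fkx] [l _ Gly]]; exists (maxn k l) => //; split.
      - by move: x Fkx; exact/subsetPset/ndF/leq_maxl.
      - by move: y Gly; exact/subsetPset/ndG/leq_maxr.
    by move=> [k _ []/= ? ?]; split; exists k.
  move=> k; have [? ?] := Foo k; have [? ?] := Goo k.
  split; first exact: measurableX.
  by rewrite product_measure1E// lte_mul_pinfty// ge0_fin_numE.
pose h (x : 'rV[R]_n.+1) : measurableTypeR R * 'rV[R]_n :=
  (x ord0 ord0, \row_j x ord0 (lift ord0 j)).
have hK : cancel (@rV_cons R n) h.
  move=> [a x]; rewrite /h rV_cons0; congr pair.
  by apply/rowP => j; rewrite mxE rV_consS.
have mh : measurable_fun setT h.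
  apply/measurable_fun_pairP; split.
    exact: measurable_coord.
  apply: measurable_fun_rV => i /=; under eq_fun do rewrite mxE.
  exact: measurable_coord.
exists (fun k => h @^-1` H k).
  by rewrite -preimage_bigcup -TH preimage_setT.
move=> k; have [mHk Hk] := mH k; split.
  by rewrite -[X in measurable X]setTI; exact: mh.
rewrite /lebesgue_rV_step /pushforward -comp_preimage.
by rewrite (_ : h \o _ = id) ?preimage_id//; apply/funext => p; exact: hK.
Qed.

HB.instance Definition _ :=
  Measure_isSigmaFinite.Build _ _ _ lebesgue_rV_step sigma_finite_step.

End lebesgue_rV_step.

Fixpoint lebesgue_rV (R : realType) n :
    {sigma_finite_measure set 'rV[R]_n -> \bar R} :=
  match n with
  | 0%N => [the {sigma_finite_measure set 'rV[R]_0 -> \bar R} of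
             @dirac _ 'rV[R]_0 0 R]
  | n'.+1 => [the {sigma_finite_measure set 'rV[R]_n'.+1 -> \bar R} of
               lebesgue_rV_step (lebesgue_rV R n')]
  end.

Lemma lebesgue_rV_box (R : realType) n (A : 'I_n -> set (measurableTypeR R)) :
  (forall i, measurable (A i)) ->
  lebesgue_rV R n [set x : 'rV[R]_n | forall i, A i (x ord0 i)] =
  (\prod_(i < n) @lebesgue_measure R (A i))%E.
Proof.
elim: n A => [|n IH] A mA /=.
  by rewrite big_ord0 diracE mem_set// => -[].
have mB : measurable [set x : 'rV[R]_n | forall j, A (lift ord0 j) (x ord0 j)].
  rewrite (_ : [set _ | _] =
      \big[setI/setT]_(j < n) [set x : 'rV[R]_n | A (lift ord0 j) (x ord0 j)]).
    apply: bigsetI_measurable => j _.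
    by rewrite -[X in measurable X]setTI; exact: (measurable_coord _ _ (mA _)).
  apply/seteqP; split => [x xA|x].
    by rewrite -bigcap_seq => j _; exact: xA.
  by rewrite -bigcap_seq => xA j; apply: (xA j); rewrite /= mem_index_enum.
rewrite big_ord_recl -IH// -product_measure1E//.
rewrite /lebesgue_rV_step /pushforward; congr product_measure1.
apply/seteqP; split => [[a x] /= xA|[a x] /= [aA xA] i].
  split; first by have := xA ord0; rewrite rV_cons0.
  by move=> j; have := xA (lift ord0 j); rewrite rV_consS.
by have [j ->|->] := unliftP ord0 i; rewrite ?rV_consS ?rV_cons0//=.
Qed.

Definition enorm (R : realType) n (x : 'rV[R]_n) : R :=
  Num.sqrt (\sum_(i < n) x ord0 i ^+ 2).

(* The Jordan parts, hence the integral, do not depend on the Hahn decomposition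
   that is picked. *)
Section signed_integral.
Context d (T : measurableType d) (R : realType).
Variable nu : {charge set T -> \bar R}.

Let P := sval (cid (Hahn_decomposition nu)).
Let N := sval (cid (svalP (cid (Hahn_decomposition nu)))).
Let nuPN : hahn_decomposition nu P N :=
  svalP (cid (svalP (cid (Hahn_decomposition nu)))).

Definition charge_integral (f : T -> R) : R :=
  \int[jordan_pos nuPN]_x f x - \int[jordan_neg nuPN]_x f x.

End signed_integral.

(* A finite R^d-valued Borel measure on R^d, given by its components, which are
   finite signed measures. *)
Definition vector_measure (R : realType) d :=
  'I_d -> {charge set 'rV[R]_d -> \bar R}.

Definition vtotal_variation (R : realType) d (F : vector_measure R d) : \bar R :=
  ereal_sup [set (\sum_(k <oo) (enorm (\row_i fine (F i (E k))))%:E)%E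
            | E in [set E : (set 'rV[R]_d)^nat |
                [/\ forall k, measurable (E k), trivIset setT E &
                    \bigcup_k E k = setT]]].

Section test_functions.
Context {R : realType} {d : nat}.
Implicit Types f phi : 'rV[R]_d -> R.

Definition partial (i : 'I_d) f : 'rV[R]_d -> R := 'D_(delta_mx ord0 i) f.

Fixpoint is_Ck (k : nat) f : Prop :=
  continuous f /\
  match k with
  | 0%N => True
  | k'.+1 => forall i : 'I_d,
      (forall x, derivable f x (delta_mx ord0 i)) /\ is_Ck k' (partial i f)
  end.

Definition test_function phi : Prop :=
  (forall k, is_Ck k phi) /\ compact (closure [set x | phi x != 0]).

Definition distributional_gradient (u : 'rV[R]_d -> R)
    (F : vector_measure R d) : Prop :=
  forall phi, test_function phi -> forall i : 'I_d,
    \int[lebesgue_rV R d]_x (u x * partial i phi x) =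
    - charge_integral (F i) phi.

End test_functions.

Record BV (R : realType) (d : nat) := {
  bv_fun :> 'rV[R]_d -> R;
  bv_grad : vector_measure R d;
  bv_integrable : (lebesgue_rV R d).-integrable [set: 'rV[R]_d] (EFin \o bv_fun);
  bv_gradP : distributional_gradient bv_fun bv_grad }.

Definition Gamma (R : realType) (s : R) : R :=
  \int[@lebesgue_measure R]_(t in `]0, +oo[) (t `^ (s - 1) * expR (- t)).

Definition heat_kernel (R : realType) d (t : R) (x : 'rV[R]_d) : R :=
  (4 * pi * t) `^ (- (d%:R / 2)) * expR (- (enorm x ^+ 2 / (4 * t))).

Definition heat_conv (R : realType) d (t : R) (F : vector_measure R d)
    (x : 'rV[R]_d) : 'rV[R]_d :=
  \row_i charge_integral (F i) (fun y => heat_kernel t (x - y)).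

(* For a finite measure F the integral over t converges absolutely for almost
   every x; at the remaining points a divergent component is set to 0. *)
Definition riesz_potential (R : realType) d (alpha : R)
    (F : vector_measure R d) (x : 'rV[R]_d) : 'rV[R]_d :=
  \row_i ((Gamma (alpha / 2))^-1 *
    \int[@lebesgue_measure R]_(t in `]0, +oo[)
      (t `^ (alpha / 2 - 1) * heat_conv t F x ord0 i)).

Definition lorentz_norm (R : realType) d m (p q : R)
    (f : 'rV[R]_d -> 'rV[R]_m) : \bar R :=
  ((p%:E * \int[@lebesgue_measure R]_(t in `]0%R, +oo[)
     ((t%:E * lebesgue_rV R d [set x | (t < enorm (f x))%R] `^ p^-1) `^ q
      * (t^-1)%:E)) `^ q^-1)%E.

(* Main.v *)
(* A Gaussian [p_s] (the heat kernel at time [s]) satisfies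
   [p_t * d_i p_s = d_i p_(t+s)], which has the sign of [- x_i] whatever [t] and
   [s] are. Hence for [u = \sum_(j < N) w_j p_(w_j^2)] there is no cancellation
   in [I_alpha Du]: its norm dominates the contribution of each summand, which
   is at least [c w_j^(alpha - d)] on the cube of the points whose coordinates
   lie between [w_j] and [2 w_j]. Take [w_j^(d - alpha) = 2^j] and let
   [p = d / (d - alpha)]. For every level [t] between [c 2^-N] and [c], the
   product of [t] and the [1/p]-th power of the measure of [|I_alpha Du| > t] is
   at least [c / 2], so the Lorentz norm is at least of order [N^(1/r)]. Each
   summand has a total variation bounded independently of its scale, whence
   [|Du| = O(N)]. As [r < 1], a large [N] concludes. *)
Require Import Defs.
From mathcomp Require Import all_boot all_order all_algebra.
From mathcomp Require Import all_classical all_reals all_analysis.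
From mathcomp Require Import measurable_realfun.
From mathcomp Require Import ring lra.

Set Implicit Arguments.
Unset Strict Implicit.
Unset Printing Implicit Defensive.

Import Order.TTheory GRing.Theory Num.Theory.
Import numFieldNormedType.Exports.

Local Open Scope classical_set_scope.
Local Open Scope ring_scope.

(** * Measurability in the space of row vectors *)

(** The gradient of p_(w^2) has an L^1 norm of order 1 / w, which the weight [w_j] offsets. On the
    other side, a function of size w^(alpha - d) on a set of measure w^d has a Lorentz norm of
    exponent p independent of w exactly when p = d / (d - alpha). So each scale costs O(1) of
    variation and adds O(1) to the integral of (t mu^(1/p))^r dt / t. These gains sit on disjoint
    ranges of levels, hence they add up before the outer power 1 / r is taken. The real-valued
    integrals used in the definitions return 0 when they diverge, so each exchange of a sum and an
    integral has to be preceded by a proof of integrability. Gaussians keep this within reach. Their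
    integrals split into one-variable ones, and the potential takes, at every point x, the closed
    form - g(|x|^2) x with [g] nonnegative and nonincreasing. The gradient is represented by charges
    with explicit densities, so that pairing with it becomes a Lebesgue integral whatever the Hahn
    decomposition. *)

Lemma measurable_box (R : realType) n (A : 'I_n -> set (measurableTypeR R)) :
  (forall i, measurable (A i)) ->
  measurable [set x : 'rV[R]_n | forall i, A i (x ord0 i)].
Proof.
move=> mA; rewrite (_ : [set _ | _] =
    \big[setI/setT]_(i < n) [set x : 'rV[R]_n | A i (x ord0 i)]).
  apply: bigsetI_measurable => i _; rewrite -[X in measurable X]setTI.
  exact: (measurable_coord _ _ (mA i)).
apply/seteqP; split => [x xA|x]; first by rewrite -bigcap_seq => i _; exact: xA.
by rewrite -bigcap_seq => xA i; apply: (xA i); rewrite /= mem_index_enum.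
Qed.

(** The sigma-algebra is generated by the coordinate maps, so openness has to be tied to it: [U] is
    the union of the countably many cubes [B p], with rational centre and radius the inverse of a
    positive integer, that it contains. A radius below [e / 2] keeps such a cube around [x] inside
    the sup-norm ball of radius [e]. *)
Lemma open_measurable_rV (R : realType) n (U : set 'rV[R]_n) :
  open U -> measurable U.
Proof.
move=> oU.
pose B (p : 'rV[rat]_n * nat) : set 'rV[R]_n :=
  [set x | forall i, `|ratr (p.1 ord0 i) - x ord0 i| < p.2.+1%:R^-1].
have mB p : measurable (B p).
  apply: (@measurable_box R n
    (fun i => [set y | `|ratr (p.1 ord0 i) - y| < p.2.+1%:R^-1])) => i.
  set q : R := ratr _; set e : R := _^-1.
  rewrite (_ : [set _ | _] = `]q - e, q + e[%classic).
    exact: measurable_itv.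
  by apply/seteqP; split => y /=; rewrite in_itv/= -ltr_distlC distrC.
have -> : U = \bigcup_(p in [set p | B p `<=` U]) B p.
  apply/seteqP; split => [x Ux|x [p pU /pU]//].
  have /nbhs_ballP[e /= e0 eU] : nbhs x U by rewrite nbhsE; exists U.
  have [N Ne] : exists N : nat, N.+1%:R^-1 < e / 2.
    have e20 : 0 < e / 2 by rewrite divr_gt0.
    exists (Num.truncn (e / 2)^-1).
    by rewrite invf_plt ?posrE// truncnS_gt.
  have N0 : (0 : R) < N.+1%:R^-1 by rewrite invr_gt0.
  have q i : exists q : rat, `|ratr q - x ord0 i| < N.+1%:R^-1.
    have [|q] := @rat_in_itvoo R
        (x ord0 i - N.+1%:R^-1) (x ord0 i + N.+1%:R^-1).
      by rewrite ltrD2l gtrN.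
    by rewrite in_itv/= => qx; exists q; rewrite ltr_distl.
  exists (\row_i sval (cid (q i)), N).
    move=> y /= By; apply: eU; split => // i j.
    have := svalP (cid (q j)); have := By j; rewrite (ord1 i) !mxE.
    set a := ratr _; rewrite -ball_normE /= => h1 h2.
    rewrite (_ : _ - _ = (x ord0 j - a) + (a - y ord0 j)); last by ring.
    rewrite (le_lt_trans (ler_normD _ _))// (splitr e) ltrD//.
      by rewrite distrC (lt_trans h2).
    exact: (lt_trans h1).
  by move=> i /=; rewrite mxE; exact: (svalP (cid (q i))).
rewrite bigcup_mkcond; apply: countable_bigcupT_measurable => // p.
by case: ifP.
Qed.

Lemma continuous_measurable_rV (R : realType) n (f : 'rV[R]_n -> R) :
  continuous f -> measurable_fun [set: 'rV[R]_n] f.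
Proof.
move=> /continuousP cf.
apply: (measurability _ (RGenOpens.measurableE R)) => //.
move=> _ [_ [a [b ->] <-]]; rewrite setTI.
by apply: open_measurable_rV; apply: cf; exact: interval_open.
Qed.

(** * Signed measures with a density *)

Section charge_integral_density.
Context d (T : measurableType d) (R : realType).
Variable mu : {sigma_finite_measure set T -> \bar R}.
Variable g : T -> R.
Hypothesis intg : mu.-integrable [set: T] (EFin \o g).

(* The Radon-Nikodym densities of the two Jordan parts differ by [g] almost
   everywhere, whichever Hahn decomposition is used. *)
Lemma charge_integral_density (f : T -> R) : measurable_fun [set: T] f ->
  [bounded f x | x in [set: T]] ->
  charge_integral (induced_charge intg) f = \int[mu]_x (f x * g x).
Proof.
move=> mf bf; rewrite /charge_integral.

lazy zeta.
set nuPN := (X in jordan_pos X).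
pose nu := [the {charge set T -> \bar R} of induced_charge intg].
have numu : nu `<< mu.
  apply/null_content_dominatesP => A mA muA.
  rewrite /nu /= /induced_charge; apply: null_set_integral => //.
  exact: measurable_funTS (measurable_int _ intg).
have jpmu := jordan_pos_dominates nuPN numu.
have jnmu := jordan_neg_dominates nuPN numu.
have intf (m : {finite_measure set T -> \bar R}) :
    m.-integrable [set: T] (EFin \o f).
  rewrite (_ : _ \o _ = ((EFin \o f) \* (EFin \o cst (1%R : R)))%E).
    apply: integrableMr => //; exact: finite_measure_integrable_cst.
  by apply/funext => x /=; rewrite mule1.
pose hp := Radon_Nikodym (charge_of_finite_measure (jordan_pos nuPN)) mu.
pose hn := Radon_Nikodym (charge_of_finite_measure (jordan_neg nuPN)) mu.
have ip : mu.-integrable [set: T] hp by exact: Radon_Nikodym_integrable.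
have jp : mu.-integrable [set: T] hn by exact: Radon_Nikodym_integrable.
have fp x : hp x \is a fin_num by exact: Radon_Nikodym_fin_num.
rewrite /Rintegral.
rewrite -(Radon_Nikodym_change_of_variables jpmu measurableT (intf _)).
rewrite -(Radon_Nikodym_change_of_variables jnmu measurableT (intf _)).
rewrite -/hp -/hn.
have fhp : mu.-integrable [set: T] (fun x => ((f x)%:E * hp x)%E).
  exact: integrableMr.
have fhn : mu.-integrable [set: T] (fun x => ((f x)%:E * hn x)%E).
  exact: integrableMr.
rewrite -fineB ?integrable_fin_num//.
rewrite -integralB//; congr (fine _).
have hE : ae_eq mu [set: T] (hp \- hn)%E (EFin \o g).
  apply: integral_ae_eq => //; first exact: integrableB.
    exact: measurable_int intg.
  move=> E _ mE.
  rewrite integralB//; [|exact: integrableS ip|exact: integrableS jp].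
  rewrite /hp /hn.
  rewrite -(Radon_Nikodym_integral
    (nu := charge_of_finite_measure (jordan_pos nuPN)))//.
  rewrite -(Radon_Nikodym_integral
    (nu := charge_of_finite_measure (jordan_neg nuPN)))//.
  have /= := jordan_decomp nuPN mE.
  by rewrite /cadd/= cscaleN1 => <-.
apply: ae_eq_integral => //.
- exact: emeasurable_funB (measurable_int _ fhp) (measurable_int _ fhn).
- apply/measurable_EFinP/measurable_funM => //.
  exact/measurable_EFinP/(measurable_int _ intg).
- move: hE; apply: filterS => x /= /(_ I) hx _.
  by rewrite EFinM -hx muleBr// fin_num_adde_defr.
Qed.

End charge_integral_density.

(** * Fubini in coordinates *)

Section tensor.
Context d1 d2 (T1 : measurableType d1) (T2 : measurableType d2) (R : realType).
Variable m1 : {sigma_finite_measure set T1 -> \bar R}.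
Variable m2 : {sigma_finite_measure set T2 -> \bar R}.
Variables (f : T1 -> R) (g : T2 -> R).
Hypotheses (intf : m1.-integrable [set: T1] (EFin \o f))
  (intg : m2.-integrable [set: T2] (EFin \o g)).

Lemma measurable_tensor :
  measurable_fun [set: T1 * T2] (fun z : T1 * T2 => f z.1 * g z.2).
Proof.
have mf : measurable_fun [set: T1] f.
  exact/measurable_EFinP/(measurable_int _ intf).
have mg : measurable_fun [set: T2] g.
  exact/measurable_EFinP/(measurable_int _ intg).
by apply: measurable_funM; exact: measurableT_comp.
Qed.

Lemma integrable_tensor :
  (m1 \x m2)%E.-integrable [set: T1 * T2] (fun z => (f z.1 * g z.2)%:E).
Proof.
have mfg := measurable_tensor.
apply/integrable12ltyP; first exact/measurable_EFinP.
have If := integrableP _ _ _ intf; have Ig := integrableP _ _ _ intg.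
rewrite (_ : (fun x => _) = (fun x => `|(f x)%:E| * \int[m2]_y `|(g y)%:E|)%E).
  rewrite ge0_integralZr//.
  - rewrite lte_mul_pinfty ?ge0_fin_numE ?integral_ge0//; last by case: Ig.
    by case: If.
  - by apply: measurableT_comp => //; case: If.
  - exact: integral_ge0.
apply/funext => x; rewrite -ge0_integralZl//.
  by apply: eq_integral => y _; rewrite /= normrM EFinM.
by apply: measurableT_comp => //; case: Ig.
Qed.

Lemma Rintegral_tensor :
  \int[(m1 \x m2)%E]_z (f z.1 * g z.2) = (\int[m1]_x f x) * (\int[m2]_y g y).
Proof.
rewrite /Rintegral -fineM ?integrable_fin_num//; congr (fine _).
rewrite -(integral12_prod_meas1 integrable_tensor) /fubini_F/=.
rewrite -(fineK (integrable_fin_num measurableT intg)).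
rewrite -integralZr//; apply: eq_integral => x _.
rewrite (_ : (fun y => _) = (fun y => (f x)%:E * (g y)%:E)%E); last first.
  by apply/funext => y; rewrite EFinM.
by rewrite integralZl// fineK// integrable_fin_num.
Qed.

End tensor.

Section rV_split.
Context (R : realType) (n : nat).
Implicit Type f : 'rV[R]_n.+1 -> \bar R.

Lemma integrable_rV_cons f : measurable_fun [set: 'rV[R]_n.+1] f ->
  (lebesgue_rV R n.+1).-integrable [set: 'rV[R]_n.+1] f <->
  (@lebesgue_measure R \x lebesgue_rV R n)%E.-integrable
    [set: measurableTypeR R * 'rV[R]_n] (f \o @rV_cons R n).
Proof.
move=> mf; have mc := @measurable_rV_cons R n.
split => [/integrableP[_ foo]|intf]; last exact: (integrable_pushforward mc).
apply/integrableP; split; first exact: measurableT_comp.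
move: foo; rewrite /= /lebesgue_rV_step ge0_integral_pushforward//.
exact: measurableT_comp.
Qed.

Lemma integral_rV_cons f :
  (lebesgue_rV R n.+1).-integrable [set: 'rV[R]_n.+1] f ->
  (\int[lebesgue_rV R n.+1]_x f x =
   \int[@lebesgue_measure R \x lebesgue_rV R n]_z f (rV_cons z))%E.
Proof.
move=> intf; have mf := measurable_int _ intf.
rewrite /= /lebesgue_rV_step (integral_pushforward (@measurable_rV_cons R n))//.
exact/integrable_rV_cons.
Qed.

End rV_split.

Lemma measurable_prod_coord (R : realType) n (f : 'I_n -> R -> R) :
  (forall i, measurable_fun [set: R] (f i)) ->
  measurable_fun [set: 'rV[R]_n] (fun x => \prod_i f i (x ord0 i)).
Proof.
move=> mf; apply: measurable_prod => i _.
exact: (measurableT_comp (mf i) (@measurable_coord R n i)).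
Qed.

(** Every integral over R^n of a heat kernel, with or without a coordinate factor, is reduced to the
    line by this lemma. In dimension 0 the measure is a Dirac mass and the empty product integrates
    to 1. *)
Lemma prod_coord_integral (R : realType) n (f : 'I_n -> R -> R) :
  (forall i, (@lebesgue_measure R).-integrable [set: R] (EFin \o f i)) ->
  (lebesgue_rV R n).-integrable [set: 'rV[R]_n]
    (fun x => (\prod_i f i (x ord0 i))%:E) /\
  \int[lebesgue_rV R n]_x (\prod_i f i (x ord0 i)) =
  \prod_i \int[@lebesgue_measure R]_y f i y.
Proof.
elim: n f => [|n IH] f intf.
  have -> : (fun x : 'rV[R]_0 => \prod_i f i (x ord0 i)) = cst 1.
    by apply/funext => x; rewrite big_ord0.
  rewrite big_ord0; split.
    rewrite (_ : (fun x => _) = EFin \o cst 1).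
      exact: (@finite_measure_integrable_cst _ _ R (@dirac _ 'rV[R]_0 0 R)).
    by apply/funext => x /=; rewrite big_ord0.
  by rewrite /= Rintegral_cst//= indicT mulr1.
have [i1 e1] := IH (fun j => f (lift ord0 j)) (fun j => intf _).
have E z : \prod_i f i (rV_cons z ord0 i) =
    f ord0 z.1 * \prod_j f (lift ord0 j) (z.2 ord0 j).
  rewrite big_ord_recl rV_cons0; congr *%R.
  by apply: eq_bigr => j _; rewrite rV_consS.
have I : (lebesgue_rV R n.+1).-integrable [set: 'rV[R]_n.+1]
    (fun x => (\prod_i f i (x ord0 i))%:E).
  apply/integrable_rV_cons.
    apply/measurable_EFinP; apply: measurable_prod_coord => i.
    by apply/measurable_EFinP; exact: (measurable_int _ (intf i)).
  rewrite (_ : _ \o _ = (fun z : measurableTypeR R * 'rV[R]_n =>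
      (f ord0 z.1 * \prod_j f (lift ord0 j) (z.2 ord0 j))%:E)).
    exact: (integrable_tensor (intf ord0) i1).
  by apply/funext => z /=; rewrite E.
split => //; rewrite big_ord_recl -e1 -(Rintegral_tensor (intf ord0) i1).
rewrite {1}/Rintegral integral_rV_cons//; congr (fine _).
by apply: eq_integral => z _; rewrite E.
Qed.

(** * Integration by parts *)

Section line_integral.
Context {R : realType}.
Let mu := @lebesgue_measure R.

(** The fundamental theorem on symmetric intervals leaves boundary terms that tend to 0; dominated
    convergence, with [|f|] as majorant, reaches the whole line. *)
Lemma integral_derive_eq0 (F f : R -> R) :
  (forall x, is_derive x (1 : R) F (f x)) -> continuous f ->
  mu.-integrable [set: R] (EFin \o f) ->
  F x @[x --> +oo%R] --> (0 : R) -> F x @[x --> -oo%R] --> (0 : R) ->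
  (\int[mu]_x (f x)%:E = 0)%E.
Proof.
move=> dF cf intf Fy FNy.
have dFx x : derivable F x 1 by case: (dF x).
have cF : continuous F.
  by move=> x; apply: differentiable_continuous; exact/derivable1_diffP.
(* [n.+1] rather than [n]: the fundamental theorem asks for a nondegenerate interval. *)
pose I n : set R := `[- n.+1%:R, n.+1%:R]%classic.
pose f_ n := (EFin \o f) \_ (I n).
have mf : measurable_fun [set: R] f by exact: continuous_measurable_fun.
have intE n : (\int[mu]_x f_ n x = (F n.+1%:R - F (- n.+1%:R))%:E)%E.
  rewrite -integral_mkcond EFinB.
  apply: continuous_FTC2 => //.
  - by rewrite gtrN// ltr0n.
  - exact: continuous_subspaceT.
  - split => [x _||]; first exact: dFx.
      exact/cvg_at_right_filter/cF.
    exact/cvg_at_left_filter/cF.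
  - by move=> x _; rewrite derive1E; case: (dF x).
have [] := @dominated_convergence _ _ _ mu [set: R] measurableT f_ (EFin \o f)
  (fun x => `|(f x)%:E|)%E.
- move=> n; apply/(measurable_restrictT _ _).1 => //.
    exact: measurable_itv.
  by apply: measurable_funTS; exact/measurable_EFinP.
- exact/measurable_EFinP.
- apply: aeW => x _; apply: cvg_near_cst; near=> n.
  rewrite /f_ /= patchE mem_set// /I /= in_itv/= -ler_norml.
  rewrite (le_trans (ltW (truncnS_gt _)))// ler_nat ltnS.
  by near: n; exact: nbhs_infty_ge.
- exact: integrable_abse.
- apply: aeW => x n _; rewrite /f_ /= patchE.
  by case: ifP => // _; rewrite abse0.
move=> _ _ cvg_int.
have cvg0 : (\int[mu]_x f_ n x)%E @[n --> \oo] --> (0%:E : \bar R).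
  under eq_fun do rewrite intE.
  apply: cvg_EFin; first exact: nearW.
  have ny : (fun n => n.+1%:R : R) @ \oo --> +oo.
    by rewrite (cvg_shiftS (fun n => n%:R : R)); exact: cvgr_idn.
  have Nny : (fun n => - n.+1%:R : R) @ \oo --> -oo by exact/cvgNrNy.
  have := cvgB (cvg_comp _ _ ny Fy) (cvg_comp _ _ Nny FNy).
  rewrite subr0 => h. exact: h.
by rewrite (cvg_unique _ cvg_int cvg0).
Unshelve. all: by end_near. Qed.

End line_integral.

(** A directional derivative sees a function only along one line, so it can be carried to another
    space in which the line is parametrised in the same way. This is how coordinates are frozen
    below. *)
Lemma is_derive_line (R : realType) (V V' : normedModType R) (f : V -> R)
    (g : V' -> R) x v x' v' df :
  (forall h : R, f (h *: v + x) = g (h *: v' + x')) ->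
  is_derive x v f df -> is_derive x' v' g df.
Proof.
move=> fg [dfx <-].
have f0 : f x = g x' by have := fg 0; rewrite !scale0r !add0r.
have E : (fun h : R => h^-1 *: ((f \o shift x) (h *: v) - f x)) =
         (fun h : R => h^-1 *: ((g \o shift x') (h *: v') - g x')).
  by apply/funext => h /=; rewrite fg f0.
by split; [rewrite /derivable -E | rewrite /derive -E].
Qed.

Lemma rV_consD0 (R : realType) n (a h : R) (y : 'rV[R]_n) :
  rV_cons (h + a, y) = h *: delta_mx ord0 ord0 + rV_cons (a, y).
Proof.
apply/rowP => j; rewrite [RHS]mxE [X in _ = X + _]mxE [X in _ = _ * X + _]mxE.
have [k ->|->] := unliftP ord0 j.
  by rewrite !rV_consS /= mulr0 add0r.
by rewrite !rV_cons0 /= mulr1.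
Qed.

Lemma rV_consDS (R : realType) n (a h : R) (y : 'rV[R]_n) (i : 'I_n) :
  rV_cons (a, h *: delta_mx ord0 i + y) =
  h *: delta_mx ord0 (lift ord0 i) + rV_cons (a, y).
Proof.
apply/rowP => j; rewrite [RHS]mxE [X in _ = X + _]mxE [X in _ = _ * X + _]mxE.
have [k ->|->] := unliftP ord0 j.
  by rewrite !rV_consS /= !mxE (inj_eq lift_inj).
by rewrite !rV_cons0 /= mulr0 add0r.
Qed.

Lemma measurable_consl (R : realType) n (a : R) :
  measurable_fun [set: 'rV[R]_n] (fun y => @rV_cons R n (a, y)).
Proof.
exact: (measurableT_comp (@measurable_rV_cons R n) (pair1_measurable _)).
Qed.

Section partial_integral.
Context {R : realType}.

(** The majorant is [C] times the indicator of the cube [-K, K]^n, a product of one-variable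
    indicators. *)
Lemma bounded_box_integrable n (f : 'rV[R]_n -> R) (K C : R) :
  measurable_fun [set: 'rV[R]_n] f -> (forall x, `|f x| <= C) ->
  (forall x : 'rV[R]_n, (exists j, K < `|x ord0 j|) -> f x = 0) ->
  (lebesgue_rV R n).-integrable [set: 'rV[R]_n] (EFin \o f).
Proof.
move=> mf fC f0.
pose A : set R := `[- K, K]%classic.
have iA : (@lebesgue_measure R).-integrable [set: R] (EFin \o \1_A).
  exact: integrable_indic_itv.
have [iP _] := @prod_coord_integral R n (fun=> \1_A) (fun=> iA).
apply: (@le_integrable _ _ _ _ _ measurableT _ (fun x : 'rV[R]_n =>
   (C * \prod_i \1_A (x ord0 i))%:E)).
- exact/measurable_EFinP.
- move=> x _ /=; rewrite lee_fin.
  have C0 : 0 <= C by exact: le_trans (fC x).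
  have [[j xj]|xK] := pselect (exists j, K < `|x ord0 j|).
    by rewrite f0 ?normr0//; exists j.
  rewrite big1 ?mulr1 ?(ger0_norm C0)// => j _.
  rewrite indicE mem_set// /A /= in_itv/= -ler_norml leNgt; apply/negP => xj.
  by apply: xK; exists j.
- under eq_fun do rewrite EFinM.
  exact: integrableZl.
Qed.

(* The fundamental theorem of calculus in the coordinate [i], the other
   coordinates being integrated out by induction on the dimension. *)
Lemma partial_integral_eq0 n (i : 'I_n) (w D : 'rV[R]_n -> R) (K C : R) :
  measurable_fun [set: 'rV[R]_n] D ->
  (forall x : 'rV[R]_n, is_derive x (delta_mx ord0 i : 'rV[R]_n) w (D x)) ->
  (forall x : 'rV[R]_n,
     continuous (fun h : R => D (h *: delta_mx ord0 i + x))) ->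
  (forall x, `|D x| <= C) ->
  (forall x : 'rV[R]_n, (exists j, K < `|x ord0 j|) -> w x = 0 /\ D x = 0) ->
  (\int[lebesgue_rV R n]_x (D x)%:E = 0)%E.
Proof.
elim: n i w D => [[]//|n IH] i w D mD dw cD DC w0.
have intD : (lebesgue_rV R n.+1).-integrable [set: 'rV[R]_n.+1] (EFin \o D).
  by apply: (bounded_box_integrable (K := K) mD DC) => x /w0[].
have intD' := (integrable_rV_cons (measurable_int _ intD)).1 intD.
rewrite (integral_rV_cons intD).
have [j ij|i0] := unliftP ord0 i.
  rewrite -(integral12_prod_meas1 intD') /fubini_F /=.
  apply: integral0_eq => a _.
  apply: (IH j (fun y => w (rV_cons (a, y))) (fun y => D (rV_cons (a, y)))).
  - exact: (measurableT_comp mD (measurable_consl a)).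
  - move=> y; apply: is_derive_line (dw (rV_cons (a, y))) => h.
    by rewrite rV_consDS ij.
  - move=> y; under eq_fun do rewrite rV_consDS -ij; exact: cD.
  - by move=> y; exact: DC.
  - by move=> y [k yk]; apply: w0; exists (lift ord0 k); rewrite rV_consS.
(* Here [i] is the first coordinate: Fubini is used in the other order, so that the inner integral
   runs along the direction of differentiation. The support condition makes the boundary terms
   vanish. *)
rewrite -(integral21_prod_meas1 intD') /fubini_G /=.
apply: integral0_eq => y _.
have E (a h : R) : rV_cons (h + a, y) = h *: delta_mx ord0 i + rV_cons (a, y).
  by rewrite rV_consD0 i0.
have cDy : continuous (fun a => D (rV_cons (a, y))).
  rewrite (_ : (fun a => _) =
      (fun h => D (h *: delta_mx ord0 i + rV_cons (0, y)))).
    exact: cD.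
  by apply/funext => a; rewrite -E addr0.
have y0 (a : R) : K < `|a| -> w (rV_cons (a, y)) = 0 /\ D (rV_cons (a, y)) = 0.
  by move=> Ka; apply: w0; exists ord0; rewrite rV_cons0.
apply: (@integral_derive_eq0 R (fun a => w (rV_cons (a, y)))) => //.
- move=> a; apply: is_derive_line (dw (rV_cons (a, y))) => h.
  by rewrite -E /GRing.scale /= mulr1.
- have iK : (@lebesgue_measure R).-integrable [set: R]
      (EFin \o (cst C \* \1_(`[- K, K]%classic))%R).
    rewrite (_ : _ \o _ = (fun x => C%:E * (\1_(`[- K, K]%classic) x)%:E)%E).
      by apply: integrableZl => //; exact: integrable_indic_itv.
    by apply/funext => x.
  apply: le_integrable iK => //.
    by apply/measurable_EFinP; exact: continuous_measurable_fun.
  move=> a _ /=; rewrite lee_fin.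
  have C0 : 0 <= C by exact: le_trans (DC 0).
  have [Ka|Ka] := ltP K `|a|; first by rewrite (y0 _ Ka).2 normr0.
  by rewrite indicE mem_set/= ?in_itv/= -?ler_norml// mulr1 (ger0_norm C0).
- apply: cvg_near_cst; near=> a; apply: (y0 _ _).1.
  rewrite (lt_le_trans _ (ler_norm _))//.
  by near: a; apply: nbhs_pinfty_gt; exact: num_real.
- apply: cvg_near_cst; near=> a; apply: (y0 _ _).1.
  rewrite -normrN (lt_le_trans _ (ler_norm _))// ltrNr.
  by near: a; apply: nbhs_ninfty_lt; exact: num_real.
Unshelve. all: by end_near. Qed.

End partial_integral.

(** * Gaussian kernels *)

Section gauss1.
Context {R : realType}.
Let mu := @lebesgue_measure R.
Implicit Types (s t x y m : R).

Definition gauss_kernel t x : R :=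
  (Num.sqrt (4 * pi * t))^-1 * expR (- (x ^+ 2 / (4 * t))).

Local Notation gk := gauss_kernel.

Lemma gauss_kernel_gt0 t x : 0 < t -> 0 < gk t x.
Proof.
move=> t0; rewrite mulr_gt0 ?expR_gt0// invr_gt0 sqrtr_gt0.
by rewrite !mulr_gt0 ?pi_gt0.
Qed.

(** Total mass and integrability are inherited from the normal density of variance [2 * t]. *)
Lemma gauss_kernel_normal t x m : 0 < t ->
  gk t (x - m) = normal_pdf m (Num.sqrt (2 * t)) x.
Proof.
move=> t0; have t20 : 0 < 2 * t by rewrite mulr_gt0.
rewrite normal_pdfE ?gt_eqF ?sqrtr_gt0//.
rewrite /normal_peak /normal_fun sqr_sqrtr ?ltW//.
rewrite /gauss_kernel mulNr -2!(mulr_natl _ 2).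
by congr ((Num.sqrt _)^-1 * expR (- (_ / _))); ring.
Qed.

Lemma continuous_gauss_kernel t : continuous (gk t).
Proof.
move=> x; apply: cvgM; first exact: cvg_cst.
apply: (cvg_comp _ expR); last exact: continuous_expR.
apply: cvgN; apply: cvgM; last exact: cvg_cst.
exact: sqr_continuous.
Qed.

Lemma is_derive_gauss_kernel t x : 0 < t ->
  is_derive x (1 : R) (gk t) (- (x / (2 * t)) * gk t x).
Proof.
move=> t0; pose q (x : R) : R := - (4 * t)^-1 * x ^+ 2.
have d1 : is_derive x (1 : R) q (- (4 * t)^-1 * (2 * x)).
  by apply: is_derive_eq; rewrite /GRing.scale /= !mulr1 (mulr_natl x 2).
have d2 := is_derive1_comp (is_derive_expR (q x)) d1.
rewrite (_ : gk t = (Num.sqrt (4 * pi * t))^-1 \*: (expR \o q)); last first.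
  apply/funext => y; rewrite /gauss_kernel /GRing.scale /= /q mulNr.
  by congr (_ * expR (- _)); rewrite mulrC.
apply: is_derive_eq; rewrite /gauss_kernel /GRing.scale /= /q mulNr.
rewrite -[_ *: _]/(_ * _); set c := _^-1; set e := expR _.
by field; rewrite gt_eqF.
Qed.

(* Completing the square; [t * s / (t + s)] and [x * s / (t + s)] are the variance
   parameter and the mean of the resulting Gaussian in [y]. *)
Lemma gauss_kernel_conv s t x y : 0 < s -> 0 < t ->
  gk t (x - y) * gk s y =
  gk (t + s) x * gk (t * s / (t + s)) (y - x * s / (t + s)).
Proof.
move=> s0 t0; have st0 : 0 < t + s by rewrite addr_gt0.
have p0 : 0 < pi :> R by exact: pi_gt0.
rewrite /gauss_kernel mulrACA [RHS]mulrACA -!expRD -!invfM -!sqrtrM;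
  last 2 first.
- by rewrite ltW// !mulr_gt0.
- by rewrite ltW// !mulr_gt0.
congr ((Num.sqrt _)^-1 * expR _).
  by field; rewrite gt_eqF.
by field; rewrite !gt_eqF.
Qed.

Lemma integrable_gauss_kernel_shift t m : 0 < t ->
  mu.-integrable [set: R] (fun y => (gk t (y - m))%:E).
Proof.
move=> t0; under eq_fun do rewrite gauss_kernel_normal//.
exact: integrable_normal_pdf.
Qed.

Lemma integral_gauss_kernel_shift t m : 0 < t ->
  \int[mu]_y gk t (y - m) = 1.
Proof.
move=> t0; rewrite /Rintegral.
under eq_integral do rewrite gauss_kernel_normal//.
by rewrite integral_normal_pdf.
Qed.

(** Follows from 1 + v <= exp v and 2 |z| <= 1 + z^2. The factor 1/8 is what doubling the time of a
    Gaussian leaves over: with z = x / sqrt t, it is x^2 / (4 t) - x^2 / (8 t) = z^2 / 8. *)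
Lemma le_expR_sqr (z : R) : `|z| <= 4 * expR (z ^+ 2 / 8).
Proof.
have E : `|z| ^+ 2 = z ^+ 2 by rewrite real_normK// num_real.
have := expR_ge1Dx (z ^+ 2 / 8); have := sqr_ge0 (`|z| - 1).
by rewrite sqrrB1 E -(mulr_natl _ 2); lra.
Qed.

(* Absorbs the factor [|x|] in a Gaussian of twice the variance. *)
Lemma norm_gauss_kernel_le t x : 0 < t ->
  `|x| * gk t x <= 6 * Num.sqrt t * gk (2 * t) x.
Proof.
move=> t0; have st0 : 0 < Num.sqrt t by rewrite sqrtr_gt0.
have h := le_expR_sqr (x / Num.sqrt t).
have -> : gk t x =
    Num.sqrt 2 * (gk (2 * t) x * expR (- ((x / Num.sqrt t) ^+ 2 / 8))).
  rewrite /gauss_kernel -[X in _ = _ * X]mulrA [RHS]mulrA -expRD.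
  congr (_ * expR _).
    rewrite (_ : 4 * pi * (2 * t) = 2 * (4 * pi * t)); last by ring.
    rewrite (@sqrtrM _ 2 (4 * pi * t))// invfM mulrA divff ?mul1r//.
  by rewrite expr_div_n sqr_sqrtr ?ltW//; field; rewrite gt_eqF.
move: h; rewrite normrM normfV (gtr0_norm st0) ler_pdivrMr//.
rewrite expRN; set E := expR _ => h.
have E0 : 0 < E by exact: expR_gt0.
have g0 := @gauss_kernel_gt0 (2 * t) x (mulr_gt0 (@ltr0n R 2) t0).
(* The constant 6 is 4 * (3 / 2): 4 comes from [le_expR_sqr], and [3 / 2] bounds the ratio sqrt 2 of
   the two normalisations. *)
have s2 : Num.sqrt 2 <= 3 / 2 :> R.
  rewrite -(ler_sqr (sqrtr_ge0 _)) ?nnegrE// ?sqr_sqrtr//; lra.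
rewrite (_ : `|x| * _ = `|x| / E * (Num.sqrt 2 * gk (2 * t) x)); last by ring.
rewrite (_ : 6 * _ * _ = (4 * Num.sqrt t) * (3 / 2 * gk (2 * t) x));
  last by field.
apply: ler_pM.
- by rewrite divr_ge0// ltW.
- by rewrite mulr_ge0// ltW.
- by rewrite ler_pdivrMr//; apply: le_trans h _; rewrite mulrAC.
- by rewrite ler_pM2r.
Qed.

Lemma integrable_id_gauss_kernel t : 0 < t ->
  mu.-integrable [set: R] (fun y => (y * gk t y)%:E).
Proof.
move=> t0; have t20 : 0 < 2 * t by rewrite mulr_gt0.
have ig : mu.-integrable [set: R]
    (fun y => (6 * Num.sqrt t)%:E * (gk (2 * t) (y - 0))%:E)%E.
  by apply: integrableZl => //; exact: integrable_gauss_kernel_shift.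
apply: le_integrable ig => //.
  apply/measurable_EFinP; apply: continuous_measurable_fun => y.
  by apply: cvgM; [exact: cvg_id|exact: continuous_gauss_kernel].
move=> y _; rewrite -EFinM lee_fin normrM (gtr0_norm (gauss_kernel_gt0 _ _))//.
by rewrite subr0 (le_trans (norm_gauss_kernel_le _ _))// ler_norm.
Qed.

Lemma Rintegral_norm_gauss_kernel t : 0 < t ->
  \int[mu]_y (`|y| * gk t y) <= 6 * Num.sqrt t.
Proof.
move=> t0; have t20 : 0 < 2 * t by rewrite mulr_gt0.
have I := integrable_gauss_kernel_shift 0 t20.
have -> : 6 * Num.sqrt t = \int[mu]_y (6 * Num.sqrt t * gk (2 * t) (y - 0)).
  by rewrite RintegralZl// integral_gauss_kernel_shift// mulr1.
apply: le_Rintegral => //.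
- have := integrable_abse (integrable_id_gauss_kernel t0).
  apply: eq_integrable => // y _ /=.
  by rewrite normrM (gtr0_norm (gauss_kernel_gt0 _ _)).
- rewrite (_ : _ \o _ =
      (fun y : R => (6 * Num.sqrt t)%:E * (gk (2 * t) (y - 0))%:E)%E)//.
  exact: integrableZl.
- by move=> y _; rewrite subr0 norm_gauss_kernel_le.
Qed.

Lemma cvg_gauss_kernel (F : set_system R) (f : R -> R) t : Filter F -> 0 < t ->
  f x @[x --> F] --> +oo -> gk t (f x) @[x --> F] --> (0 : R).
Proof.
move=> FF t0 Fy; rewrite -[0 in X in _ --> X](mulr0 (Num.sqrt (4 * pi * t))^-1).
pose c := (Num.sqrt (4 * t))^-1.
rewrite (_ : (fun x => _) =
    (fun x => (Num.sqrt (4 * pi * t))^-1 * gauss_fun (f x * c))).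
  apply: cvgM; first exact: cvg_cst.
  apply: (cvg_comp _ _ _ (@cvg_gauss_fun R)).
  apply/gt0_cvgMly; last exact: Fy.
  by rewrite invr_gt0 sqrtr_gt0 mulr_gt0.
apply/funext => x; rewrite /gauss_kernel /gauss_fun /c.
by rewrite exprMn exprVn sqr_sqrtr// ltW// mulr_gt0.
Qed.

Lemma integral_center_gauss_kernel t m : 0 < t ->
  mu.-integrable [set: R] (fun y => ((y - m) * gk t (y - m))%:E) /\
  \int[mu]_y ((y - m) * gk t (y - m)) = 0.
Proof.
move=> t0.
have cf : continuous (fun y : R => (y - m) * gk t (y - m)).
  move=> y; have c : y - m @[y --> y] --> y - m.
    by apply: cvgB; [exact: cvg_id|exact: cvg_cst].
  by apply: cvgM => //; apply: (cvg_comp _ _ c); exact: continuous_gauss_kernel.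
have I : mu.-integrable [set: R] (fun y => ((y - m) * gk t (y - m))%:E).
  have t20 : 0 < 2 * t by rewrite mulr_gt0.
  have ig : mu.-integrable [set: R]
      (fun y => (6 * Num.sqrt t)%:E * (gk (2 * t) (y - m))%:E)%E.
    by apply: integrableZl => //; exact: integrable_gauss_kernel_shift.
  apply: le_integrable ig => //.
    by apply/measurable_EFinP; exact: continuous_measurable_fun.
  move=> y _; rewrite -EFinM lee_fin normrM.
  rewrite (gtr0_norm (gauss_kernel_gt0 _ _))//.
  by rewrite (le_trans (norm_gauss_kernel_le _ _))// ler_norm.
split => //.
suff -> : \int[mu]_y ((y - m) * gk t (y - m)) = fine (0 : \bar R) by [].
congr (fine _).
(* The integrand z * gk t z, with z = y - m, has the primitive - 2 t * gk t z, which vanishes at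
   both ends. *)
apply: (@integral_derive_eq0 R (fun y => - (2 * t) * gk t (y - m)) _ _ cf I).
- move=> y.
  pose q (y : R) : R := y - m.
  have d1 : is_derive y (1 : R) q 1 by apply: is_derive_eq; rewrite subr0.
  have d2 := is_derive1_comp (is_derive_gauss_kernel (q y) t0) d1.
  rewrite (_ : (fun y => _) = - (2 * t) \*: (gk t \o q))//.
  apply: is_derive_eq; rewrite -[_ *: _]/(_ * _) mulr1.
  rewrite -/(q y); set e := gk t _.
  by field; rewrite gt_eqF.
- have h : gk t (y - m) @[y --> +oo] --> (0 : R).
    by apply: cvg_gauss_kernel => //; exact: cvg_addrr.
  by have := cvgM (cvg_cst (- (2 * t))) h; rewrite mulr0 => h'; exact: h'.
- have h : gk t (y - m) @[y --> -oo] --> (0 : R).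
    rewrite (_ : (fun y => _) = (fun y => gk t (- (y - m)))); last first.
      by apply/funext => y; rewrite /gauss_kernel sqrrN.
    by apply: cvg_gauss_kernel => //; apply/cvgNry; exact: cvg_addrr_Ny.
  by have := cvgM (cvg_cst (- (2 * t))) h; rewrite mulr0 => h'; exact: h'.
Qed.

Lemma integrable_gauss_conv s t x : 0 < s -> 0 < t ->
  mu.-integrable [set: R] (fun y => (gk t (x - y) * gk s y)%:E) /\
  \int[mu]_y (gk t (x - y) * gk s y) = gk (t + s) x.
Proof.
move=> s0 t0; have c0 : 0 < t * s / (t + s).
  by rewrite divr_gt0 ?addr_gt0 ?mulr_gt0.
have I := integrable_gauss_kernel_shift (x * s / (t + s)) c0.
have E := fun y => @gauss_kernel_conv s t x y s0 t0.
split.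
  under eq_fun do rewrite E EFinM.
  exact: integrableZl.
under eq_Rintegral do rewrite E.
by rewrite RintegralZl// integral_gauss_kernel_shift// mulr1.
Qed.

(** After completing the square, [y] is integrated against a Gaussian of mean [m]. Writing y = m +
    (y - m), the first part gives [m] and the centred part integrates to 0. *)
Lemma integrable_gauss_conv_id s t x : 0 < s -> 0 < t ->
  mu.-integrable [set: R] (fun y => (gk t (x - y) * (y * gk s y))%:E) /\
  \int[mu]_y (gk t (x - y) * (y * gk s y)) = x * s / (t + s) * gk (t + s) x.
Proof.
move=> s0 t0; have c0 : 0 < t * s / (t + s).
  by rewrite divr_gt0 ?addr_gt0 ?mulr_gt0.
pose m := x * s / (t + s).
have I := integrable_gauss_kernel_shift m c0.
have [J J0] := integral_center_gauss_kernel m c0.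
have E y : gk t (x - y) * (y * gk s y) =
    gk (t + s) x * (m * gk (t * s / (t + s)) (y - m)) +
    gk (t + s) x * ((y - m) * gk (t * s / (t + s)) (y - m)).
  by rewrite mulrCA gauss_kernel_conv// -/m; ring.
have I1 : mu.-integrable [set: R]
    (fun y => (gk (t + s) x * (m * gk (t * s / (t + s)) (y - m)))%:E).
  by under eq_fun do rewrite !EFinM; do 2 apply: integrableZl => //.
have J1 : mu.-integrable [set: R]
    (fun y => (gk (t + s) x * ((y - m) * gk (t * s / (t + s)) (y - m)))%:E).
  by under eq_fun do rewrite EFinM; exact: integrableZl.
split.
  under eq_fun do rewrite E EFinD.
  exact: integrableD.
under eq_Rintegral do rewrite E.
have K : mu.-integrable [set: R]
    (fun y => (m * gk (t * s / (t + s)) (y - m))%:E).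
  by under eq_fun do rewrite EFinM; exact: integrableZl.
rewrite RintegralD// (RintegralZl _ measurableT K).
rewrite (RintegralZl _ measurableT I) (RintegralZl _ measurableT J) J0.
by rewrite integral_gauss_kernel_shift// mulr0 addr0 mulr1 mulrC.
Qed.

End gauss1.

Section gauss_rV.
Context {R : realType} {d : nat}.
Let mu := lebesgue_rV R d.
Local Notation gk := gauss_kernel.
Implicit Types (s t : R) (x y : 'rV[R]_d) (i : 'I_d).

Lemma enorm_sqr x : enorm x ^+ 2 = \sum_i x ord0 i ^+ 2.
Proof. by rewrite sqr_sqrtr// sumr_ge0// => i _; rewrite sqr_ge0. Qed.

Lemma heat_kernelE t x : 0 < t -> heat_kernel t x = \prod_i gk t (x ord0 i).
Proof.
move=> t0; rewrite big_split/= prodr_const card_ord -expR_sum sumrN -mulr_suml.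
have a0 : 0 <= 4 * pi * t by rewrite !mulr_ge0 ?pi_ge0// ltW.
rewrite /heat_kernel enorm_sqr powRN [_ / 2]mulrC powRrM powR12_sqrt//.
by rewrite powR_mulrn ?sqrtr_ge0// exprVn.
Qed.

Lemma heat_kernel_gt0 t x : 0 < t -> 0 < heat_kernel t x.
Proof.
move=> t0; rewrite heat_kernelE// prodr_gt0// => i _.
exact: gauss_kernel_gt0.
Qed.

Lemma continuous_prod_coord (f : 'I_d -> R -> R) :
  (forall i, continuous (f i)) ->
  continuous (fun x => \prod_i f i (x ord0 i)).
Proof.
move=> cf; elim: (index_enum _) => [|j r IH] x.
  rewrite (_ : (fun x => _) = cst 1); first exact: cst_continuous.
  by apply/funext => y; rewrite big_nil.
rewrite (_ : (fun x => _) =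
    (fun x => f j (x ord0 j) * \prod_(i <- r) f i (x ord0 i))); last first.
  by apply/funext => y; rewrite big_cons.
apply: (@continuousM _ _ (fun x => f j (x ord0 j))); last exact: IH.
apply: (cvg_comp _ (f j)); last exact: cf.
exact: coord_continuous.
Qed.

Lemma continuous_heat_kernel t : 0 < t -> continuous (@heat_kernel R d t).
Proof.
move=> t0; rewrite (_ : heat_kernel t = (fun x => \prod_i gk t (x ord0 i))).
  apply: (@continuous_prod_coord (fun=> gk t)) => i.
  exact: continuous_gauss_kernel.
by apply/funext => x; rewrite heat_kernelE.
Qed.

Lemma is_derive_heat_kernel t x i : 0 < t ->
  is_derive x (delta_mx ord0 i : 'rV[R]_d) (heat_kernel t)
    (- (2 * t)^-1 * (x ord0 i * heat_kernel t x)).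
Proof.
move=> t0.
pose c := \prod_(k < d | k != i) gk t (x ord0 k).
pose q (h : R) : R := h + x ord0 i.
have d1 : is_derive (0 : R) (1 : R) q 1 by apply: is_derive_eq; rewrite addr0.
have d2 := is_derive1_comp (is_derive_gauss_kernel (q 0) t0) d1.
have d3 : is_derive (0 : R) (1 : R) (c \*: (gk t \o q))
    (- (2 * t)^-1 * (x ord0 i * heat_kernel t x)).
  apply: is_derive_eq; rewrite -[_ *: _]/(_ * _) heat_kernelE//.
  rewrite (bigD1 i)//= -/c /q add0r mulr1.
  by set e := gk t _; ring.
apply: is_derive_line d3 => h.
rewrite heat_kernelE// (bigD1 i)//= !mxE !eqxx /= addr0 /q.
rewrite /GRing.scale /= !mulr1.
rewrite mulrC; congr (_ * _); apply: eq_bigr => k ki.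
by rewrite !mxE (negbTE ki) andbF mulr0 add0r.
Qed.

(** Absorbs a factor depending on the coordinate [i] alone into the [i]-th factor of a product, the
    shape that [prod_coord_integral] requires. *)
Let prod_mark i (a b : 'I_d -> R) :
  \prod_k (if k == i then a k * b k else b k) = a i * \prod_k b k.
Proof.
rewrite (bigD1 i)//= eqxx [in RHS](bigD1 i)//= mulrA; congr *%R.
by apply: eq_bigr => k /negbTE ->.
Qed.

Lemma integrable_heat_kernel t : 0 < t ->
  mu.-integrable [set: 'rV[R]_d] (EFin \o heat_kernel t).
Proof.
move=> t0; rewrite (_ : _ \o _ = (fun x => (\prod_i gk t (x ord0 i))%:E)).
  have Igk : (@lebesgue_measure R).-integrable [set: R] (EFin \o gk t).
    have := integrable_gauss_kernel_shift 0 t0.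
    by under eq_fun do rewrite subr0.
  exact: (@prod_coord_integral R d (fun=> gk t) (fun=> Igk)).1.
by apply/funext => x /=; rewrite heat_kernelE.
Qed.

(** The factors other than the [i]-th have mass one, so the one-dimensional moment bound survives
    without a dimensional constant. The same factorisation serves twice, with [a] the identity for
    integrability and the absolute value for the bound. *)
Lemma integrable_coord_heat_kernel t i : 0 < t ->
  mu.-integrable [set: 'rV[R]_d] (fun x => (x ord0 i * heat_kernel t x)%:E) /\
  \int[mu]_x (`|x ord0 i| * heat_kernel t x) <= 6 * Num.sqrt t.
Proof.
move=> t0.
pose f (a : R -> R) (k : 'I_d) (z : R) :=
  if k == i then a z * gk t z else gk t z.
have fE a x : a (x ord0 i) * heat_kernel t x = \prod_k f a k (x ord0 k).
  rewrite heat_kernelE//.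
  by rewrite -(prod_mark i (fun k => a (x ord0 k)) (fun k => gk t (x ord0 k))).
have Igk : (@lebesgue_measure R).-integrable [set: R] (EFin \o gk t).
  have := integrable_gauss_kernel_shift 0 t0.
  by under eq_fun do rewrite subr0.
have Iid := integrable_id_gauss_kernel t0.
have Iabs : (@lebesgue_measure R).-integrable [set: R]
    (fun z => (`|z| * gk t z)%:E).
  apply: eq_integrable (integrable_abse Iid) => // z _ /=.
  by rewrite normrM (gtr0_norm (gauss_kernel_gt0 _ _)).
have If k : (@lebesgue_measure R).-integrable [set: R] (EFin \o f id k).
  by rewrite /f; case: (k == i).
have Ifn k : (@lebesgue_measure R).-integrable [set: R] (EFin \o f Num.norm k).
  by rewrite /f; case: (k == i).
split.
  under eq_fun do rewrite (fE id).
  exact: (prod_coord_integral If).1.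
under eq_Rintegral do rewrite (fE Num.norm).
rewrite (prod_coord_integral Ifn).2.
rewrite (bigD1 i)//= big1; last first.
  move=> k /negbTE ki; rewrite /f ki.
  rewrite -[RHS](integral_gauss_kernel_shift 0 t0).
  by apply: eq_Rintegral => z _; rewrite subr0.
by rewrite mulr1 /f eqxx; exact: Rintegral_norm_gauss_kernel.
Qed.

(** Multiplied by - (2 s)^-1, this is p_t * d_i p_s = d_i p_(t+s), obtained by direct computation
    instead of by differentiating a convolution. *)
Lemma heat_kernel_conv s t x i : 0 < s -> 0 < t ->
  mu.-integrable [set: 'rV[R]_d]
    (fun y => (heat_kernel t (x - y) * (y ord0 i * heat_kernel s y))%:E) /\
  \int[mu]_y (heat_kernel t (x - y) * (y ord0 i * heat_kernel s y)) =
  x ord0 i * s / (t + s) * heat_kernel (t + s) x.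
Proof.
move=> s0 t0; have st0 : 0 < t + s by rewrite addr_gt0.
pose f (k : 'I_d) (z : R) := if k == i then gk t (x ord0 k - z) * (z * gk s z)
                             else gk t (x ord0 k - z) * gk s z.
have fE y : heat_kernel t (x - y) * (y ord0 i * heat_kernel s y) =
    \prod_k f k (y ord0 k).
  rewrite !heat_kernelE// mulrCA -big_split/=.
  rewrite -(prod_mark i (fun k => y ord0 k)
    (fun k => gk t ((x - y) ord0 k) * gk s (y ord0 k))); apply: eq_bigr => k _.
  by rewrite !mxE /f; case: ifP => // _; rewrite mulrCA.
have If k : (@lebesgue_measure R).-integrable [set: R] (EFin \o f k).
  rewrite /f; case: (k == i).
    exact: (integrable_gauss_conv_id _ s0 t0).1.
  exact: (integrable_gauss_conv _ s0 t0).1.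
have [I E] := prod_coord_integral If.
split; first by under eq_fun do rewrite fE.
under eq_Rintegral do rewrite fE.
rewrite E heat_kernelE//.
rewrite -(prod_mark i (fun k => x ord0 k * s / (t + s))
  (fun k => gk (t + s) (x ord0 k))); apply: eq_bigr => k _; rewrite /f.
case: eqP => [->|_]; first exact: (integrable_gauss_conv_id _ s0 t0).2.
exact: (integrable_gauss_conv _ s0 t0).2.
Qed.

End gauss_rV.

(** * Compact supports and integration by parts against test functions *)

Lemma compact_support_bounded (R : realType) n (S : set 'rV[R]_n)
    (f : 'rV[R]_n -> R) : compact S -> continuous f ->
  (forall x, ~ S x -> f x = 0) -> exists C, forall x, `|f x| <= C.
Proof.
move=> cS cf f0.
have /compact_bounded[M [_ HM]] : compact (f @` S).
  by apply: continuous_compact cS; exact: continuous_subspaceT.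
have M1 : M < `|M| + 1 by rewrite (le_lt_trans (ler_norm _))// ltrDl.
exists (`|M| + 1) => x; have [Sx|/f0 ->] := pselect (S x).
  by apply: (HM _ M1); exists x.
by rewrite normr0 addr_ge0.
Qed.

Lemma compact_rV_box (R : realType) n (S : set 'rV[R]_n) : compact S ->
  exists K, forall x : 'rV[R]_n, (exists j, K < `|x ord0 j|) -> ~ S x.
Proof.
move=> /compact_bounded[M [_ HM]]; exists (`|M| + 1) => x [j xj] Sx.
have M1 : M < `|M| + 1 by rewrite (le_lt_trans (ler_norm _))// ltrDl.
have /= := HM _ M1 x Sx; rewrite leNgt => /negP; apply.
apply: lt_le_trans xj _; rewrite [leRHS]/Num.norm /= mx_normrE.
by apply: (le_trans _ (le_bigmax _ _ (ord0, j))).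
Qed.

Lemma continuous_line (R : realType) n (f : 'rV[R]_n -> R) (v x : 'rV[R]_n) :
  continuous f -> continuous (fun h : R => f (h *: v + x)).
Proof.
move=> cf h; apply: (cvg_comp (fun h : R => h *: v + x) f); last exact: cf.
by apply: cvgD; [exact: scalel_continuous|exact: cvg_cst].
Qed.

Section by_parts.
Context {R : realType} {d : nat}.
Let mu := lebesgue_rV R d.

Lemma partial_support (phi : 'rV[R]_d -> R) i x :
  ~ closure [set x | phi x != 0] x -> partial i phi x = 0.
Proof.
move=> ncl; rewrite /partial.
rewrite (@near_eq_derive _ _ _ phi (cst 0)); first by rewrite derive_cst.
have : (~` closure [set x | phi x != 0]) x by [].
rewrite -interiorC; apply: filterS => y /negP.
by rewrite negbK => /eqP.
Qed.

(** The product [u * phi] has compact support even though [u] need not, so the integral of its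
    [i]-th derivative [D] vanishes. *)
Lemma integration_by_parts_rV (u g phi : 'rV[R]_d -> R) i :
  continuous u -> continuous g ->
  (forall x, is_derive x (delta_mx ord0 i : 'rV[R]_d) u (g x)) ->
  test_function phi ->
  \int[mu]_x (u x * partial i phi x) = - \int[mu]_x (phi x * g x).
Proof.
move=> cu cg dg tphi; have [Cphi cS] := tphi.
have [cphi /(_ i)[dphi [cpphi _]]] := Cphi 1%N.
pose S := closure [set x | phi x != 0].
have phi0 x : ~ S x -> phi x = 0.
  move=> nS; apply/eqP; apply: contrapT => /negP p0; apply: nS.
  exact: subset_closure.
have pphi0 x : ~ S x -> partial i phi x = 0 by exact: partial_support.
have [K SK] := compact_rV_box cS.
have I1c : continuous (fun x => u x * partial i phi x).
  by move=> x; exact: (continuousM (cu x) (cpphi x)).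
have I2c : continuous (fun x => phi x * g x).
  by move=> x; exact: (continuousM (cphi x) (cg x)).
have I (f : 'rV[R]_d -> R) : continuous f -> (forall x, ~ S x -> f x = 0) ->
    mu.-integrable [set: 'rV[R]_d] (EFin \o f).
  move=> cf f0; have [C fC] := compact_support_bounded cS cf f0.
  apply: (bounded_box_integrable (K := K) (C := C)) => //.
    exact: continuous_measurable_rV.
  by move=> x /SK/f0.
have z1 x : ~ S x -> u x * partial i phi x = 0.
  by move=> /pphi0 ->; rewrite mulr0.
have z2 x : ~ S x -> phi x * g x = 0 by move=> /phi0 ->; rewrite mul0r.
apply/eqP; rewrite -addr_eq0 -RintegralD//; [|exact: I|exact: I].
pose D x := u x * partial i phi x + phi x * g x.
have cD : continuous D.
  by move=> x; exact: (continuousD (I1c x) (I2c x)).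
have D0 x : ~ S x -> D x = 0 by move=> Sx; rewrite /D z1// z2// addr0.
have [C DC] := compact_support_bounded cS cD D0.
suff D_int : (\int[mu]_x (D x)%:E = 0)%E by rewrite /Rintegral D_int.
apply: (@partial_integral_eq0 R d i (u * phi) D K C).
- exact: continuous_measurable_rV.
- move=> x; have dphix : is_derive x (delta_mx ord0 i) phi (partial i phi x).
    by split; [exact: dphi|].
  exact: is_deriveM.
- by move=> x; exact: continuous_line.
- by [].
- by move=> x /SK Sx; split; [rewrite /GRing.mul/= phi0// mulr0|exact: D0].
Qed.

End by_parts.

Lemma Rintegral_sum d (T : measurableType d) (R : realType)
    (mu : {measure set T -> \bar R}) (D : set T) n (f : 'I_n -> T -> R) :
  measurable D -> (forall j, mu.-integrable D (EFin \o f j)) ->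
  mu.-integrable D (fun x => (\sum_j f j x)%:E) /\
  \int[mu]_(x in D) (\sum_j f j x) = \sum_j \int[mu]_(x in D) f j x.
Proof.
move=> mD intf.
have E : (fun x => (\sum_j f j x)%:E) = (fun x => (\sum_j (EFin \o f j) x)%E).
  by apply/funext => x; rewrite /= sumEFin.
rewrite /Rintegral E; split; first exact: integrable_sum.
rewrite integral_sum// sum_fine// => j _.
exact: (integrable_fin_num mD (intf j)).
Qed.

Lemma enorm_le_sum (R : realType) n (v : 'rV[R]_n) :
  enorm v <= \sum_i `|v ord0 i|.
Proof.
have s0 : 0 <= \sum_i `|v ord0 i| by exact: sumr_ge0.
rewrite -(ler_sqr (sqrtr_ge0 _) s0)// enorm_sqr expr2 mulr_suml.
apply: ler_sum => i _; rewrite -real_normK ?num_real// expr2 ler_wpM2l//.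
by rewrite (bigD1 i)//= lerDl sumr_ge0.
Qed.

Lemma norm_le_enorm (R : realType) n (v : 'rV[R]_n) i : `|v ord0 i| <= enorm v.
Proof.
rewrite -(ler_sqr (normr_ge0 _) (sqrtr_ge0 _)) enorm_sqr real_normK ?num_real//.
by rewrite (bigD1 i)//= lerDl sumr_ge0// => j _; exact: sqr_ge0.
Qed.

Lemma continuous_sum (R : realType) n m (f : 'I_m -> 'rV[R]_n -> R) :
  (forall j, continuous (f j)) -> continuous (fun x => \sum_j f j x).
Proof.
move=> cf; elim: (index_enum _) => [|j r IH] x.
  rewrite (_ : (fun x => _) = cst 0); first exact: cst_continuous.
  by apply/funext => y; rewrite big_nil.
rewrite (_ : (fun x => _) = (fun x => f j x + \sum_(i <- r) f i x)); last first.
  by apply/funext => y; rewrite big_cons.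
exact: (continuousD (cf j x) (IH x)).
Qed.

(** * Sums of Gaussians as functions of bounded variation *)

Section vtotal_variation_density.
Context {R : realType} {d : nat}.
Let mu := lebesgue_rV R d.
Variable g : 'I_d -> 'rV[R]_d -> R.
Hypothesis intg : forall i, mu.-integrable [set: 'rV[R]_d] (EFin \o g i).

(** On each piece of a partition the Euclidean norm is bounded by the sum of the absolute values of
    the coordinates, and the pieces recombine by countable additivity. The loss depends on [d]
    only. *)
Lemma vtotal_variation_density_le :
  (vtotal_variation (fun i => induced_charge (intg i)) <=
   (\sum_i \int[mu]_x `|g i x|)%:E)%E.
Proof.
pose h x := \sum_i `|g i x|.
have Iabs i : mu.-integrable [set: 'rV[R]_d] (fun x => `|g i x|%:E).
  exact: integrable_abse (intg i).
have hE : (fun x => (h x)%:E) = (fun x => (\sum_i `|g i x|%:E)%E).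
  by apply/funext => x; rewrite sumEFin.
have Ih : mu.-integrable [set: 'rV[R]_d] (fun x => (h x)%:E).
  by rewrite hE; apply: integrable_sum.
have hint A : measurable A ->
    (\int[mu]_(x in A) (h x)%:E =
     (\sum_i fine (\int[mu]_(x in A) `|g i x|%:E))%:E)%E.
  move=> mA; rewrite hE integral_sum//; last first.
    by move=> i; exact: integrableS (Iabs i).
  rewrite -sumEFin; apply: eq_bigr => i _; rewrite fineK// integrable_fin_num//.
  exact: integrableS (Iabs i).
rewrite /Rintegral -(hint setT)//.
apply: ge_ereal_sup => _ [E [mE tE UE] <-].
rewrite -UE ge0_integral_bigcup//; last 2 first.
- by rewrite UE; exact: measurable_int Ih.
- by move=> x _; rewrite lee_fin sumr_ge0.
apply: lee_nneseries => [k _ _|k _]; first by rewrite lee_fin sqrtr_ge0.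
rewrite hint// lee_fin (le_trans (enorm_le_sum _))//.
apply: ler_sum => i _; rewrite mxE /induced_charge.
have J : mu.-integrable (E k) (EFin \o g i) by exact: integrableS (intg i).
exact: (le_normr_Rintegral (mE k) J).
Qed.

End vtotal_variation_density.

Section gauss_sum.
Context {R : realType} {d : nat}.
Let mu := lebesgue_rV R d.
Variables (N : nat) (w : nat -> R).
Hypothesis w0 : forall j, 0 < w j.

Definition gauss_sum (x : 'rV[R]_d) : R :=
  \sum_(j < N) w j * heat_kernel (w j ^+ 2) x.

Definition gauss_sum_grad (i : 'I_d) (x : 'rV[R]_d) : R :=
  \sum_(j < N) - (2 * w j)^-1 * (x ord0 i * heat_kernel (w j ^+ 2) x).

Let w20 j : 0 < w j ^+ 2. Proof. exact: exprn_gt0. Qed.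

Let continuous_gauss_sum : continuous gauss_sum.
Proof.
apply: continuous_sum => j x.
apply: (@continuousM _ _ (fun=> w j)); first exact: cst_continuous.
exact: continuous_heat_kernel.
Qed.

Let continuous_gauss_sum_grad i : continuous (gauss_sum_grad i).
Proof.
apply: continuous_sum => j x.
apply: (@continuousM _ _ (fun=> - (2 * w j)^-1)
  (fun x : 'rV[R]_d => x ord0 i * heat_kernel (w j ^+ 2) x)).
  exact: cst_continuous.
apply: (@continuousM _ _ (fun x : 'rV[R]_d => x ord0 i)).
  exact: coord_continuous.
exact: continuous_heat_kernel.
Qed.

Let integrable_gauss_sum : mu.-integrable [set: 'rV[R]_d] (EFin \o gauss_sum).
Proof.
rewrite (_ : _ \o _ =
    (fun x => \sum_(j < N) ((w j)%:E * (heat_kernel (w j ^+ 2) x)%:E))%E).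
  apply: integrable_sum => // j _; apply: integrableZl => //.
  exact: integrable_heat_kernel.
by apply/funext => x /=; rewrite -sumEFin; apply: eq_bigr => j _; rewrite EFinM.
Qed.

Let integrable_gauss_sum_grad i :
  mu.-integrable [set: 'rV[R]_d] (EFin \o gauss_sum_grad i).
Proof.
rewrite (_ : _ \o _ = (fun x : 'rV[R]_d => \sum_(j < N)
    ((- (2 * w j)^-1)%:E * (x ord0 i * heat_kernel (w j ^+ 2) x)%:E))%E).
  apply: integrable_sum => // j _; apply: integrableZl => //.
  exact: (integrable_coord_heat_kernel i (w20 j)).1.
by apply/funext => x /=; rewrite -sumEFin; apply: eq_bigr => j _; rewrite EFinM.
Qed.

Let is_derive_gauss_sum i (x : 'rV[R]_d) :
  is_derive x (delta_mx ord0 i : 'rV[R]_d) gauss_sum (gauss_sum_grad i x).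
Proof.
rewrite (_ : gauss_sum = \sum_(j < N) (w j \*: heat_kernel (w j ^+ 2)));
  last first.
  by apply/funext => y; rewrite fct_sumE.
apply: is_derive_sum => j; have h := is_derive_heat_kernel x i (w20 j).
apply: is_derive_eq; rewrite -[LHS]/(_ * _) mulrA; congr *%R.
by have := w0 j; rewrite lt0r => /andP[? _]; field.
Qed.

Definition gauss_sum_charge (i : 'I_d) : {charge set 'rV[R]_d -> \bar R} :=
  induced_charge (integrable_gauss_sum_grad i).

Let gauss_sum_gradP : distributional_gradient gauss_sum gauss_sum_charge.
Proof.
move=> phi tphi i; have [Cphi cS] := tphi.
have cphi : continuous phi := (Cphi 0%N).1.
have phi0 x : ~ closure [set x | phi x != 0] x -> phi x = 0.
  move=> nS; apply/eqP; apply: contrapT => /negP p0; apply: nS.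
  exact: subset_closure.
have [C phiC] := compact_support_bounded cS cphi phi0.
rewrite charge_integral_density//; last 2 first.
- exact: continuous_measurable_rV.
- exists C; split; first exact: num_real.
  by move=> D CD x _ /=; rewrite (le_trans (phiC x))// ltW.
exact: integration_by_parts_rV.
Qed.

Definition gauss_sum_BV : BV R d :=
  Build_BV integrable_gauss_sum gauss_sum_gradP.

(** For one coordinate and one summand the bound is (2 w)^-1 * 6 * sqrt (w^2) = 3: the scale
    cancels. *)
Lemma vtotal_variation_gauss_sum :
  (vtotal_variation (bv_grad gauss_sum_BV) <= (3 * d%:R * N%:R)%:E)%E.
Proof.
apply: le_trans (vtotal_variation_density_le _) _; rewrite lee_fin.
suff h i : \int[mu]_x `|gauss_sum_grad i x| <= 3 * N%:R.
  rewrite (le_trans (ler_sum _ (fun i _ => h i)))//.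
  by rewrite sumr_const card_ord -[leLHS]mulr_natr mulrAC.
have Ij j : mu.-integrable [set: 'rV[R]_d]
    (fun x => (`|x ord0 i| * heat_kernel (w j ^+ 2) x)%:E).
  have := integrable_abse (integrable_coord_heat_kernel i (w20 j)).1.
  apply: eq_integrable => // x _ /=.
  by rewrite normrM (gtr0_norm (heat_kernel_gt0 _ _)).
have Icj (j : 'I_N) : mu.-integrable [set: 'rV[R]_d]
    (fun x => ((2 * w j)^-1 * (`|x ord0 i| * heat_kernel (w j ^+ 2) x))%:E).
  by under eq_fun do rewrite EFinM; exact: integrableZl.
have [Ih hE] := Rintegral_sum measurableT Icj.
have w2 j : 0 < (2 * w j)^-1 by rewrite invr_gt0 mulr_gt0.
rewrite (@le_trans _ _ (\int[mu]_x \sum_(j < N)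
    (2 * w j)^-1 * (`|x ord0 i| * heat_kernel (w j ^+ 2) x)))//.
  apply: le_Rintegral => //.
    exact: integrable_abse (integrable_gauss_sum_grad i).
  move=> x _; rewrite (le_trans (ler_norm_sum _ _ _))// ler_sum// => j _.
  rewrite normrM normrN (gtr0_norm (w2 j)) normrM.
  by rewrite (gtr0_norm (heat_kernel_gt0 _ (w20 j))).
rewrite hE (_ : 3 * N%:R = \sum_(j < N) 3); last first.
  by rewrite sumr_const card_ord mulr_natr.
apply: ler_sum => j _.
rewrite (RintegralZl _ measurableT (Ij j)) mulrC ler_pdivrMr ?mulr_gt0//.
rewrite (le_trans (integrable_coord_heat_kernel i (w20 j)).2)//.
by rewrite sqrtr_sqr gtr0_norm//; lra.
Qed.

Lemma heat_conv_gauss_sum t (x : 'rV[R]_d) i : 0 < t ->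
  heat_conv t (bv_grad gauss_sum_BV) x ord0 i =
  - (x ord0 i * \sum_(j < N)
      w j / (2 * (t + w j ^+ 2)) * heat_kernel (t + w j ^+ 2) x).
Proof.
move=> t0; rewrite mxE.
have ch : continuous (fun y : 'rV[R]_d => @heat_kernel R d t (x - y)).
  move=> y; apply: (cvg_comp (fun y : 'rV[R]_d => x - y) (heat_kernel t));
    last first.
    exact: continuous_heat_kernel.
  apply: (@continuousB _ _ _ (fun=> x) (fun y : 'rV[R]_d => y)).
    exact: cst_continuous.
  exact: cvg_id.
rewrite charge_integral_density; last 2 first.
- exact: continuous_measurable_rV.
(* [charge_integral_density] needs a bounded integrand; the heat kernel is bounded by its value at
   the origin. *)
- exists ((4 * pi * t) `^ (- (d%:R / 2))); split; first exact: num_real.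
  move=> D CD y _ /=; rewrite (le_trans _ (ltW CD))//.
  rewrite (gtr0_norm (heat_kernel_gt0 _ t0)) ler_piMr ?powR_ge0//.
  by rewrite -[leRHS]expR0 ler_expR oppr_le0 divr_ge0 ?sqr_ge0// mulr_ge0// ltW.
have hc j := heat_kernel_conv x i (w20 j) t0.
have Icj (j : 'I_N) : mu.-integrable [set: 'rV[R]_d] (fun y => (- (2 * w j)^-1 *
    (heat_kernel t (x - y) * (y ord0 i * heat_kernel (w j ^+ 2) y)))%:E).
  by under eq_fun do rewrite EFinM; apply: integrableZl => //; exact: (hc j).1.
have [_ E] := Rintegral_sum measurableT Icj.
transitivity (\int[mu]_y \sum_(j < N) (- (2 * w j)^-1 *
    (heat_kernel t (x - y) * (y ord0 i * heat_kernel (w j ^+ 2) y)))).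
  apply: eq_Rintegral => y _; rewrite mulr_sumr.
  by apply: eq_bigr => j _; rewrite mulrCA.
rewrite E mulr_sumr -sumrN; apply: eq_bigr => j _.
rewrite (RintegralZl _ measurableT (hc j).1) (hc j).2.
have ? : w j != 0 by rewrite gt_eqF.
have ? : t + w j ^+ 2 != 0 by rewrite gt_eqF// addr_gt0.
by field; apply/andP.
Qed.

End gauss_sum.

Lemma measurable_sqr (R : realType) :
  measurable_fun [set: R] (fun x : R => x ^+ 2).
Proof. exact: measurable_funX. Qed.

Lemma measurable_invr (R : realType) :
  measurable_fun [set: R] (fun x : R => x^-1).
Proof.
(* Real powers are known to be measurable and give the inverse on nonnegative numbers; squaring
   removes the sign. At 0 both sides are 0. *)
rewrite (_ : (fun x => _) = (fun x : R => x * ((x ^+ 2) `^ (-1)))); last first.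
  apply/funext => x; rewrite powR_inv1 ?sqr_ge0// expr2.
  have [->|x0] := eqVneq x 0; first by rewrite !mul0r invr0.
  by field.
apply: measurable_funM => //.
exact: (measurableT_comp (measurable_powR _) (@measurable_sqr R)).
Qed.

(** * The time integral in the Riesz potential *)

Section dominator.
Context {R : realType}.
Variables (a s : R).
Hypotheses (a0 : 0 < a) (s0 : 0 < s).
Let mu := @lebesgue_measure R.

(* [(t / (t + s)) `^ a / (a * s)] is a bounded primitive of [dominator]. *)
Definition dominator (t : R) : R := (t / (t + s)) `^ a / (t * (t + s)).

Let F (t : R) : R := (a * s)^-1 * expR (a * (ln t - ln (t + s))).

Lemma dominatorE t : 0 < t ->
  dominator t = expR (a * (ln t - ln (t + s))) / (t * (t + s)).
Proof.
move=> t0; have ts0 : 0 < t + s by rewrite addr_gt0.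
by rewrite /dominator /powR gt_eqF ?divr_gt0// ln_div ?posrE.
Qed.

Lemma dominator_ge0 t : 0 <= t -> 0 <= dominator t.
Proof.
move=> t0; have ts0 : 0 <= t + s by rewrite addr_ge0// ltW.
by rewrite /dominator divr_ge0 ?powR_ge0// mulr_ge0.
Qed.

Lemma measurable_dominator : measurable_fun [set: R] dominator.
Proof.
have mts : measurable_fun [set: R] (fun t : R => t + s).
  exact: measurable_funD.
have m1 : measurable_fun [set: R] (fun t : R => t / (t + s)).
  apply: measurable_funM; first exact: measurable_id.
  exact: (measurableT_comp (@measurable_invr R) mts).
have m2 : measurable_fun [set: R] (fun t : R => t * (t + s)).
  by apply: measurable_funM; first exact: measurable_id.
apply: measurable_funM.
  exact: (measurableT_comp (measurable_powR a) m1).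
exact: (measurableT_comp (@measurable_invr R) m2).
Qed.

Let is_derive_F (t : R) : 0 < t ->
  is_derive t (1 : R) F (expR (a * (ln t - ln (t + s))) / (t * (t + s))).
Proof.
move=> t0; have ts0 : 0 < t + s by rewrite addr_gt0.
pose p (t : R) : R := t + s.
have d0 : is_derive t (1 : R) p 1 by apply: is_derive_eq; rewrite addr0.
have d1 := is_derive1_comp (is_derive1_ln (ts0 : 0 < p t)) d0.
have d2 := is_derive1_ln t0.
pose q (t : R) : R := a * (ln t - ln (t + s)).
have d3 : is_derive t (1 : R) q (a * (t^-1 - (t + s)^-1)).
  rewrite (_ : q = a \*: (@ln R - (@ln R \o p)))//.
  by apply: is_derive_eq; rewrite mulr1.
have d4 := is_derive1_comp (is_derive_expR (q t)) d3.
rewrite (_ : F = (a * s)^-1 \*: (expR \o q))//.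
apply: is_derive_eq; rewrite -[LHS]/(_ * _) -/(q t); set e := expR _.
by field; rewrite !gt_eqF.
Qed.

Let dominator_segment (b c : R) : 0 < b -> b < c ->
  (\int[mu]_(t in `[b, c]) (dominator t)%:E <= ((a * s)^-1)%:E)%E.
Proof.
move=> b0 bc; pose f (t : R) := expR (a * (ln t - ln (t + s))) / (t * (t + s)).
have pos (t : R) : t \in `[b, c] -> 0 < t.
  by rewrite in_itv/= => /andP[/(lt_le_trans b0)].
have cF (t : R) : 0 < t -> {for t, continuous F}.
  move=> t0; apply: differentiable_continuous; apply/derivable1_diffP.
  by case: (is_derive_F t0).
have cf (t : R) : 0 < t -> {for t, continuous f}.
  move=> t0; have ts0 : 0 < t + s by rewrite addr_gt0.
  have c1 : {for t, continuous (fun t : R => t + s)}.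
    by apply: cvgD; [exact: cvg_id|exact: cvg_cst].
  have c2 : {for t, continuous (fun t : R => ln (t + s))}.
    exact: (continuous_comp c1 (continuous_ln ts0)).
  have c3 : {for t, continuous (fun t : R => t * (t + s))}.
    by apply: (@continuousM _ _ id) => //; exact: cvg_id.
  have c4 : {for t, continuous (fun t : R => (t * (t + s))^-1)}.
    by apply: continuousV c3; rewrite mulf_neq0// gt_eqF.
  have c5 : {for t, continuous (fun t : R => a * (ln t - ln (t + s)))}.
    apply: (@continuousM _ _ (fun=> a)); first exact: cvg_cst.
    by apply: (@continuousB _ _ _ (@ln R)) => //; exact: continuous_ln.
  apply: (@continuousM _ _ (fun t => expR (a * (ln t - ln (t + s))))) => //.
  exact: (continuous_comp c5 (@continuous_expR R _)).
rewrite (_ : (\int[mu]_(t in `[b, c]) _ =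
    \int[mu]_(t in `[b, c]) (f t)%:E)%E); last first.
  by apply: eq_integral => t /[1!inE] /pos t0; rewrite dominatorE.
have c0 := lt_trans b0 bc.
rewrite (@continuous_FTC2 R f F b c bc).
- rewrite -EFinB lee_fin /F -mulrBr.
  apply: ler_piMr; first by rewrite invr_ge0 mulr_ge0// ltW.
  rewrite lerBlDr (@le_trans _ _ 1) ?lerDl ?expR_ge0//.
  rewrite -[leRHS]expR0 ler_expR pmulr_rle0// subr_le0.
  by rewrite ler_ln ?posrE ?addr_gt0// lerDl ltW.
- apply: continuous_in_subspaceT => t /[1!inE] /pos; exact: cf.
- split.
  + move=> t tbc; have t0 : 0 < t by apply: pos; exact: subset_itv_oo_cc tbc.
    by case: (is_derive_F t0).
  + exact/cvg_at_right_filter/cF.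
  + exact/cvg_at_left_filter/cF.
- move=> t tbc; have t0 : 0 < t by apply: pos; exact: subset_itv_oo_cc tbc.
  by rewrite derive1E; case: (is_derive_F t0).
Qed.

(** For t > 0 this function is t^(a-1) (t+s)^(-a-1), integrable at 0 and of order t^-2 at infinity.
    It majorises both the Gamma integrand and the Riesz integrands. The primitive stays between 0
    and (a s)^-1, which bounds the integral over every segment, and monotone convergence
    concludes. *)
Lemma integrable_dominator : mu.-integrable `]0, +oo[ (EFin \o dominator).
Proof.
apply/integrableP; split.
  apply: measurable_funTS; apply/measurable_EFinP.
  exact: measurable_dominator.
(* [n.+2] makes the left end smaller than the right one already for n = 0. *)
pose D n : set R := `[n.+2%:R^-1, n.+2%:R]%classic.
have UD : `]0, +oo[%classic = \bigcup_n D n.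
  apply/seteqP; split => t /=; last first.
    move=> [n _]; rewrite /D/= !in_itv/= andbT => /andP[+ _].
    exact: lt_le_trans.
  rewrite in_itv/= andbT => t0.
  exists (maxn (Num.truncn t) (Num.truncn t^-1)) => //; rewrite /D/= in_itv/=.
  have h (x : R) k : (Num.truncn x <= k)%N -> x <= k.+2%:R.
    move=> xk; rewrite (le_trans (ltW (truncnS_gt x)))// ler_nat.
    exact: leqW.
  rewrite h ?leq_maxl// andbT invf_ple ?posrE//.
  by rewrite h ?leq_maxr.
have mD n : measurable (D n) by exact: measurable_itv.
have mf n : measurable_fun (D n) (fun t => `|(dominator t)%:E|)%E.
  apply: measurable_funTS; apply: measurableT_comp => //.
  by apply/measurable_EFinP; exact: measurable_dominator.
have ndD : {homo D : n m / (n <= m)%N >-> (n <= m)%O}.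
  move=> n m nm; apply/subsetPset => t; rewrite /D/= !in_itv/= => /andP[nt tn].
  rewrite (le_trans _ nt) ?(le_trans tn) ?ler_nat//.
  by rewrite lef_pV2 ?posrE// ler_nat.
have c := @ge0_nondecreasing_set_cvg_integral _ (measurableTypeR R) R D _
  (@lebesgue_measure R) ndD mD mf (fun _ _ _ => abse_ge0 _).
rewrite UD; apply: (@le_lt_trans _ _ ((a * s)^-1)%:E); last exact: ltry.
rewrite -(cvg_lim _ c)//; apply: lime_le.
  by apply/cvg_ex; eexists; exact: c.
apply: nearW => n.
rewrite (_ : (\int[mu]_(t in D n) _ = \int[mu]_(t in D n) (dominator t)%:E)%E).
  apply: dominator_segment; first by rewrite invr_gt0.
  by rewrite (@lt_trans _ _ 1) ?invf_lt1 ?ltr1n.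
apply: eq_integral => t /[1!inE]; rewrite /D/= in_itv/= => /andP[t0 _].
by rewrite /= ger0_norm// dominator_ge0// (le_trans _ t0)// invr_ge0.
Qed.

End dominator.

Section halfline_integral.
Context {R : realType}.
Let mu := @lebesgue_measure R.

Lemma le_Rintegral_halfline (f : R -> R) (b b' c : R) : 0 < b -> b <= b' ->
  mu.-integrable `]0, +oo[ (EFin \o f) ->
  (forall t, 0 < t -> 0 <= f t) -> (forall t, b <= t <= b' -> c <= f t) ->
  c * (b' - b) <= \int[mu]_(t in `]0, +oo[) f t.
Proof.
move=> b0 bb' intf f0 cf.
have sub : `[b, b']%classic `<=` `]0, +oo[%classic.
  by move=> t /=; rewrite !in_itv/= andbT => /andP[+ _]; exact: lt_le_trans.
have mb : measurable (`[b, b']%classic : set (measurableTypeR R)).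
  exact: measurable_itv.
have m0 : measurable (`]0, +oo[%classic : set (measurableTypeR R)).
  exact: measurable_itv.
have intfb := integrableS m0 mb sub intf.
have fin : mu `[b, b'] = (b' - b)%:E.
  rewrite /mu lebesgue_measure_itv/= lte_fin -EFinB; case: ltgtP bb' => // -> _.
  by rewrite subrr.
apply: (@le_trans _ _ (\int[mu]_(t in `[b, b']) f t)).
  rewrite -[b' - b]/(fine (b' - b)%:E) -fin -Rintegral_cst//.
  apply: le_Rintegral => //.
  - apply/integrableP; split; first exact: measurable_cst.
    under eq_integral do rewrite /=.
    by rewrite integral_cst// [X in (_ * X)%E]fin -EFinM ltry.
apply: fine_le; [exact: integrable_fin_num..|].
apply: ge0_subset_integral => //; first exact: measurable_int intf.
by move=> t; rewrite /= in_itv/= andbT lee_fin => /f0.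
Qed.

Lemma integrable_dominated (f : R -> R) (a s C : R) : 0 < a -> 0 < s ->
  measurable_fun [set: R] f ->
  (forall t, 0 < t -> `|f t| <= C * dominator a s t) ->
  mu.-integrable `]0, +oo[ (EFin \o f).
Proof.
move=> a0 s0 mf fC.
have I : mu.-integrable `]0, +oo[ (fun t => C%:E * (dominator a s t)%:E)%E.
  by apply: integrableZl => //; exact: integrable_dominator.
apply: le_integrable I => //.
  by apply: measurable_funTS; exact/measurable_EFinP.
move=> t /=; rewrite in_itv/= andbT => /fC h.
by rewrite lee_fin (le_trans h)// ler_norm.
Qed.

End halfline_integral.

(** * Real powers and positivity of the Gamma function *)

Section powR_complements.
Context {R : realType}.
Implicit Types x y a c : R.

Lemma powRB1 x a : 0 < x -> x `^ (a - 1) = x `^ a / x.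
Proof.
move=> x0; rewrite powRD; last by rewrite (gt_eqF x0) implybT.
by rewrite powR_inv1// ltW.
Qed.

Lemma powR_inv x a : 0 < x -> x^-1 `^ a = x `^ (- a).
Proof. by move=> x0; rewrite -powR_inv1 ?ltW// -powRrM mulN1r. Qed.

Lemma le_powRN x y c : 0 < x -> x <= y -> 0 <= c -> y `^ (- c) <= x `^ (- c).
Proof.
move=> x0 xy c0; have y0 := lt_le_trans x0 xy.
by rewrite !powRN lef_pV2 ?posrE ?powR_gt0// ge0_ler_powR// nnegrE ltW.
Qed.

End powR_complements.

(** A divergent integral would be read as 0, so integrability comes first; the integrand is then
    bounded below on [1, 2]. *)
Lemma Gamma_gt0 (R : realType) (s : R) : 0 < s -> 0 < Gamma s.
Proof.
move=> s0; pose g (t : R) := t `^ (s - 1) * expR (- t).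
have mg : measurable_fun [set: R] g.
  apply: measurable_funM; first exact: measurable_powR.
  have mN : measurable_fun [set: R] (fun t : R => - t).
    by apply: continuous_measurable_fun; exact: opp_continuous.
  exact: (measurableT_comp (@measurable_expR R) mN).
have g0 t : 0 < t -> 0 <= g t.
  by move=> t0; rewrite mulr_ge0 ?powR_ge0 ?expR_ge0.
have I : (@lebesgue_measure R).-integrable `]0, +oo[ (EFin \o g).
  pose k := s + 1; have k0 : 0 < k by rewrite addr_gt0.
  (* The constant is the maximum of (t + 1)^k exp (- t), attained at t + 1 = k; the bound amounts to
     1 + ln v <= v at v = (t + 1) / k. *)
  apply: (@integrable_dominated R g s 1 (expR (1 - k + k * ln k))) => // t t0.
  have t10 : 0 < t + 1 by rewrite addr_gt0.
  have E : dominator s 1 t = t `^ s / t * ((t + 1) `^ (- s) / (t + 1)).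
    rewrite /dominator powRM ?invr_ge0 ?(ltW t0) ?(ltW t10)// powR_inv// invfM.
    by ring.
  rewrite ger0_norm ?g0// /g powRB1// E [leRHS]mulrCA.
  rewrite ler_wpM2l ?divr_ge0 ?powR_ge0 ?(ltW t0)//.
  rewrite -powRB1// /powR gt_eqF// -expRD ler_expR.
  have := expR_ge1Dx (ln ((t + 1) / k)).
  rewrite lnK ?posrE ?divr_gt0// ln_div ?posrE// => h.
  have : k * (1 + (ln (t + 1) - ln k)) <= t + 1.
    by rewrite -ler_pdivlMl// mulrC.
  by rewrite /k; lra.
have h t : 1 <= t <= 2 -> expR (- 2) / 2 <= g t.
  move=> /andP[t1 t2]; have t0 := lt_le_trans ltr01 t1.
  rewrite /g powRB1// mulrC; apply: ler_pM;
    rewrite ?expR_ge0 ?invr_ge0//; last first.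
    by rewrite ler_expR lerN2.
  rewrite -[leLHS]mul1r; apply: ler_pM; rewrite ?invr_ge0//; last first.
    by rewrite lef_pV2 ?posrE.
  have : 1 `^ s <= t `^ s.
    by apply: ge0_ler_powR; rewrite ?nnegrE ?(ltW s0) ?(ltW t0).
  by rewrite powR1.
apply: lt_le_trans (le_Rintegral_halfline ltr01 _ I g0 h);
  last by rewrite ler1n.
by rewrite mulr_gt0 ?divr_gt0 ?expR_gt0// subr_gt0 ltr1n.
Qed.

(** * The radial kernel produced by one Gaussian *)

Section riesz_kernel.
Context {R : realType}.
Variables (a b s : R).
Hypotheses (a0 : 0 < a) (ab : a <= b) (s0 : 0 < s).
Let mu := @lebesgue_measure R.

(** With a = alpha / 2, b = d / 2, s = w_j^2 and q = |x|^2, this is the time integrand of the [j]-th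
    summand, stripped of the factor - w_j x_i. *)
Definition riesz_integrand (q t : R) : R :=
  t `^ (a - 1) * ((2 * (t + s))^-1 *
    ((4 * pi * (t + s)) `^ (- b) * expR (- (q / (4 * (t + s)))))).

Definition riesz_kernel (q : R) : R :=
  \int[mu]_(t in `]0, +oo[) riesz_integrand q t.

Let pi0 : 0 < pi :> R. Proof. exact: pi_gt0. Qed.

Lemma riesz_integrand_ge0 q t : 0 < t -> 0 <= riesz_integrand q t.
Proof.
move=> t0; have ts0 := ltW (addr_gt0 t0 s0).
apply: mulr_ge0; first exact: powR_ge0.
apply: mulr_ge0; first by rewrite invr_ge0 mulr_ge0.
by apply: mulr_ge0; rewrite ?powR_ge0 ?expR_ge0.
Qed.

Lemma integrable_riesz q : 0 <= q ->
  mu.-integrable `]0, +oo[ (EFin \o riesz_integrand q).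
Proof.
move=> q0.
have mts (c : R) : measurable_fun [set: R] (fun t : R => c * (t + s)).
  by apply: measurable_funM => //; exact: measurable_funD.
have mtsV (c : R) : measurable_fun [set: R] (fun t : R => (c * (t + s))^-1).
  exact: (measurableT_comp (@measurable_invr R) (mts c)).
have mI : measurable_fun [set: R] (riesz_integrand q).
  apply: measurable_funM; first exact: measurable_powR.
  apply: measurable_funM; first exact: mtsV.
  apply: measurable_funM.
    exact: (measurableT_comp (measurable_powR _) (mts _)).
  have m1 : measurable_fun [set: R] (fun t : R => - (q / (4 * (t + s)))).
    have mN : measurable_fun [set: R] (fun t : R => - t).
      by apply: continuous_measurable_fun; exact: opp_continuous.
    apply: (measurableT_comp mN).
    by apply: measurable_funM; [exact: measurable_cst|exact: mtsV].
  exact: (measurableT_comp (@measurable_expR R) m1).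
(* The exponential is at most 1 and [4 * pi] at least 1; since [a <= b] and t + s >= s, (t+s)^(-b)
   is at most s^(a-b) (t+s)^(-a). *)
apply: (integrable_dominated (C := s `^ (a - b)) a0 s0 mI) => t t0.
have ts0 : 0 < t + s by rewrite addr_gt0.
rewrite ger0_norm ?riesz_integrand_ge0// /riesz_integrand /dominator.
have E : s `^ (a - b) * ((t / (t + s)) `^ a / (t * (t + s))) =
    t `^ a / t * ((t + s)^-1 * (s `^ (a - b) * (t + s) `^ (- a))).
  rewrite powRM ?invr_ge0 ?(ltW t0) ?(ltW ts0)// powR_inv// invfM.
  by ring.
rewrite powRB1// E.
rewrite ler_wpM2l ?divr_ge0 ?powR_ge0 ?(ltW t0)//.
apply: ler_pM; rewrite ?invr_ge0 ?mulr_ge0 ?powR_ge0 ?expR_ge0 ?(ltW ts0)//.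
  by rewrite lef_pV2 ?posrE ?mulr_gt0// ler_peMl ?ltW// ltr1n.
rewrite (@le_trans _ _ ((t + s) `^ (- b)))//.
  rewrite -[leRHS]mulr1 ler_pM ?powR_ge0 ?expR_ge0//.
    apply: le_powRN => //; last exact: le_trans (ltW a0) ab.
    rewrite ler_peMl ?(ltW ts0)//.
    have := @pi_ge2 R; lra.
  by rewrite -[leRHS]expR0 ler_expR oppr_le0 divr_ge0// mulr_ge0// ltW.
have -> : (t + s) `^ (- b) = (t + s) `^ (- (b - a)) * (t + s) `^ (- a).
  rewrite -powRD; last by rewrite (gt_eqF ts0) implybT.
  by congr powR; ring.
rewrite ler_wpM2r ?powR_ge0// -(opprB b a).
by apply: le_powRN => //; rewrite ?lerDr ?subr_ge0// ltW.
Qed.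

Lemma riesz_kernel_ge0 q : 0 <= riesz_kernel q.
Proof.
apply: Rintegral_ge0 => t /=; rewrite in_itv/= andbT.
exact: riesz_integrand_ge0.
Qed.

Lemma riesz_kernel_nonincreasing q q' : 0 <= q -> q <= q' ->
  riesz_kernel q' <= riesz_kernel q.
Proof.
move=> q0 qq'; apply: le_Rintegral => //.
- exact: integrable_riesz (le_trans q0 qq').
- exact: integrable_riesz.
- move=> t /=; rewrite in_itv/= andbT => t0.
  have ts0 : 0 < t + s by rewrite addr_gt0.
  rewrite ler_wpM2l ?powR_ge0// ler_wpM2l ?invr_ge0 ?mulr_ge0 ?(ltW ts0)//.
  rewrite ler_wpM2l ?powR_ge0// ler_expR lerN2 ler_wpM2r//.
  by rewrite invr_ge0 mulr_ge0// ltW.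
Qed.

(** Only the times s <= t <= 2 s are kept. There t^(a-1) >= s^a / (2 s) and 2 s <= t + s <= 3 s,
    which yields the factors (6 s)^-1, (12 pi s)^(-b) and exp (- Q / 8); the window has length
    [s]. *)
Lemma riesz_kernel_lower Q q : 0 <= q -> q <= Q * s ->
  (12 * pi) `^ (- b) * expR (- (Q / 8)) / 12 * s `^ (a - b) <=
  s * riesz_kernel q.
Proof.
move=> q0 qQ; have b0 := lt_le_trans a0 ab.
pose c := s `^ a / (2 * s) * ((6 * s)^-1 *
  ((12 * pi * s) `^ (- b) * expR (- (Q / 8)))).
have -> : (12 * pi) `^ (- b) * expR (- (Q / 8)) / 12 * s `^ (a - b) =
    s * (c * (2 * s - s)).
  rewrite /c (@powRM _ (12 * pi) s) ?mulr_ge0 ?(ltW s0) ?(ltW pi0)//.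
  rewrite powRD; last by rewrite (gt_eqF s0) implybT.
  by field; rewrite gt_eqF.
rewrite ler_pM2l//; apply: le_Rintegral_halfline => //.
- by rewrite ler_peMl ?(ltW s0)// ler1n.
- exact: integrable_riesz.
- by move=> t; exact: riesz_integrand_ge0.
move=> t /andP[st ts]; have t0 := lt_le_trans s0 st.
have ts0 : 0 < t + s by rewrite addr_gt0.
have [[s0' t0'] ts0'] := (ltW s0, ltW t0, ltW ts0).
rewrite /c /riesz_integrand powRB1//; apply: ler_pM.
- by rewrite divr_ge0 ?powR_ge0// mulr_ge0.
- by rewrite mulr_ge0 ?invr_ge0 ?mulr_ge0 ?powR_ge0 ?expR_ge0.
- apply: ler_pM; rewrite ?powR_ge0 ?invr_ge0 ?mulr_ge0//.
    by rewrite ge0_ler_powR ?nnegrE// ltW.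
  by rewrite lef_pV2 ?posrE ?mulr_gt0.
apply: ler_pM; rewrite ?invr_ge0 ?mulr_ge0 ?powR_ge0 ?expR_ge0//.
  by rewrite lef_pV2 ?posrE ?mulr_gt0//; lra.
apply: ler_pM; rewrite ?powR_ge0 ?expR_ge0//.
  apply: le_powRN; rewrite ?mulr_gt0 ?(ltW b0)//.
  rewrite (_ : 12 * pi * s = 4 * pi * (3 * s)); last by ring.
  by rewrite ler_pM2l ?mulr_gt0//; lra.
rewrite ler_expR lerN2 ler_pdivrMr ?mulr_gt0// (le_trans qQ)//.
have Q0 : 0 <= Q by rewrite -(pmulr_lge0 _ s0) (le_trans q0).
rewrite (_ : Q / 8 * _ = Q * ((t + s) / 2)); last by field.
by rewrite ler_wpM2l//; lra.
Qed.

End riesz_kernel.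

(** * Riesz potentials of sums of Gaussians *)

Section riesz_gauss_sum.
Context {R : realType} {d : nat}.
Variables (alpha : R) (N : nat) (w : nat -> R).
Hypotheses (alpha0 : 0 < alpha) (alphad : alpha < d%:R)
  (w0 : forall j, 0 < w j).
Let mu := lebesgue_rV R d.
Let u := @gauss_sum_BV R d N w w0.
Let a := alpha / 2.
Let b : R := d%:R / 2.

Let a0 : 0 < a. Proof. by rewrite divr_gt0. Qed.

Let ab : a <= b. Proof. by rewrite ler_pM2r ?invr_gt0// ltW. Qed.

Let w20 j : 0 < w j ^+ 2. Proof. exact: exprn_gt0. Qed.

Definition riesz_profile (q : R) : R :=
  (Gamma a)^-1 * \sum_(j < N) w j * riesz_kernel a b (w j ^+ 2) q.

(** The time integral of each summand converges at every [x], the origin included, so the default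
    value for divergent integrals is never met and no null set has to be removed. *)
Lemma riesz_potential_gauss_sum x :
  riesz_potential alpha (bv_grad u) x = - riesz_profile (enorm x ^+ 2) *: x.
Proof.
apply/rowP => i; rewrite [LHS]mxE mxE /riesz_profile -/a.
rewrite mulNr -mulrA -mulrN; congr (_ * _).
pose f (j : 'I_N) t :=
  (- (w j * x ord0 i)) * riesz_integrand a b (w j ^+ 2) (enorm x ^+ 2) t.
have I j := integrable_riesz a0 ab (w20 j) (sqr_ge0 (enorm x)).
have m0 : measurable (`]0, +oo[%classic : set (measurableTypeR R)).
  exact: measurable_itv.
have If (j : 'I_N) : (@lebesgue_measure R).-integrable `]0, +oo[ (EFin \o f j).
  rewrite (_ : _ \o _ = (fun t => (- (w j * x ord0 i))%:E *
      (riesz_integrand a b (w j ^+ 2) (enorm x ^+ 2) t)%:E)%E)//.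
  exact: (integrableZl m0 _ (I j)).
have [_ E] := Rintegral_sum m0 If.
rewrite (_ : \int[_]_(t in _) _ =
    \int[@lebesgue_measure R]_(t in `]0, +oo[) (\sum_j f j t)).
  rewrite E mulr_suml -sumrN; apply: eq_bigr => j _.
  by rewrite (RintegralZl _ m0 (I j)) mulNr mulrAC.
apply: eq_Rintegral => t /[1!inE]/=; rewrite in_itv/= andbT => t0.
rewrite heat_conv_gauss_sum// mulr_sumr mulrN mulr_sumr -sumrN.
apply: eq_bigr => j _; rewrite /f /riesz_integrand /heat_kernel -/b.
by rewrite mulNr; congr (- _); ring.
Qed.

Lemma riesz_profile_ge0 q : 0 <= riesz_profile q.
Proof.
rewrite mulr_ge0 ?invr_ge0 ?(ltW (Gamma_gt0 a0))// sumr_ge0// => j _.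
by rewrite mulr_ge0 ?riesz_kernel_ge0// ltW.
Qed.

Lemma riesz_profile_nonincreasing q q' : 0 <= q -> q <= q' ->
  riesz_profile q' <= riesz_profile q.
Proof.
move=> q0 qq'; apply: ler_wpM2l; first by rewrite invr_ge0 ltW// Gamma_gt0.
apply: ler_sum => j _; apply: ler_wpM2l; first exact: ltW.
exact: riesz_kernel_nonincreasing.
Qed.

Lemma enorm_riesz_potential x :
  enorm (riesz_potential alpha (bv_grad u) x) =
  riesz_profile (enorm x ^+ 2) * enorm x.
Proof.
rewrite riesz_potential_gauss_sum {1}/enorm.
under eq_bigr do rewrite mxE exprMn sqrrN.
by rewrite -mulr_sumr sqrtrM ?sqr_ge0// sqrtr_sqr ger0_norm ?riesz_profile_ge0.
Qed.

Lemma measurable_enorm : measurable_fun [set: 'rV[R]_d] (@enorm R d).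
Proof.
have ms : measurable_fun [set: R] (@Num.sqrt R).
  by apply: nondecreasing_measurable => // y z; exact: ler_wsqrtr.
apply: (measurableT_comp ms); apply: measurable_sum => i.
exact: (measurableT_comp (@measurable_sqr R) (@measurable_coord R d i)).
Qed.

(** The potential is radial in norm with a monotone profile, hence measurable. The profile is
    monotone for nonnegative arguments; [Num.max 0] extends this to the whole line without changing
    it at squared norms. *)
Lemma measurable_enorm_riesz :
  measurable_fun [set: 'rV[R]_d]
    (fun x => enorm (riesz_potential alpha (bv_grad u) x)).
Proof.
rewrite (_ : (fun x => _) =
    (fun x => riesz_profile (Num.max 0 (enorm x ^+ 2)) * enorm x)); last first.
  by apply/funext => x; rewrite enorm_riesz_potential max_r ?sqr_ge0.
apply: measurable_funM; last exact: measurable_enorm.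
have mp : measurable_fun [set: R] (fun q => riesz_profile (Num.max 0 q)).
  apply: nonincreasing_measurable; first exact: measurableT.
  move=> q q' qq'; apply: riesz_profile_nonincreasing.
    by rewrite le_max lexx.
  by rewrite ge_max !le_max lexx qq' orbT.
have m2 := measurableT_comp (@measurable_sqr R) measurable_enorm.
exact: (measurableT_comp mp m2).
Qed.

(** The constant of [riesz_kernel_lower] at Q = 4 d, since |x|^2 <= 4 d w_j^2 on the cube
    [w_j, 2 w_j]^d. *)
Definition riesz_const : R := (Gamma a)^-1 *
  ((12 * pi) `^ (- b) * expR (- (4 * d%:R / 8)) / 12).

Lemma riesz_const_gt0 : 0 < riesz_const.
Proof.
rewrite mulr_gt0 ?invr_gt0 ?Gamma_gt0// divr_gt0 ?mulr_gt0 ?expR_gt0//.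
by rewrite powR_gt0// mulr_gt0// pi_gt0.
Qed.

(** All terms of the profile are nonnegative, so the [j]-th one can be kept alone. One coordinate
    already gives |x| >= w_j, so w_j |x| >= w_j^2, which is the factor [s] in
    [riesz_kernel_lower]. *)
Lemma enorm_riesz_lower (j : 'I_N) (x : 'rV[R]_d) : (0 < d)%N ->
  (forall i, w j <= x ord0 i <= 2 * w j) ->
  riesz_const * w j `^ (alpha - d%:R) <=
  enorm (riesz_potential alpha (bv_grad u) x).
Proof.
move=> d0 wx; rewrite enorm_riesz_potential.
have x2 : enorm x ^+ 2 <= 4 * d%:R * w j ^+ 2.
  rewrite enorm_sqr (_ : 4 * d%:R * _ = \sum_(i < d) (2 * w j) ^+ 2).
    apply: ler_sum => i _; have /andP[h1 h2] := wx i.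
    by rewrite ler_sqr// nnegrE ?(le_trans _ h1) ?mulr_ge0 ?(ltW (w0 j)).
  by rewrite sumr_const card_ord -mulr_natr; ring.
have h := riesz_kernel_lower a0 ab (w20 j) (sqr_ge0 (enorm x)) x2.
have wE : enorm x >= w j.
  apply: le_trans (norm_le_enorm x (Ordinal d0)).
  by have /andP[h1 _] := wx (Ordinal d0); rewrite (le_trans h1)// ler_norm.
rewrite (_ : w j `^ _ = (w j ^+ 2) `^ (a - b)); last first.
  rewrite -powR_mulrn ?(ltW (w0 j))// -powRrM /a /b.
  by congr (_ `^ _); field.
rewrite /riesz_const /riesz_profile -[leLHS]mulrA -[leRHS]mulrA.
apply: ler_wpM2l; first by rewrite invr_ge0 ltW// Gamma_gt0.
apply: (le_trans h); rewrite [X in X * _]expr2 -mulrA mulrC.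
apply: ler_pM => //; first by rewrite mulr_ge0 ?riesz_kernel_ge0// ltW.
  exact: ltW.
rewrite (bigD1 j)//= lerDl; apply: sumr_ge0 => k _.
by rewrite mulr_ge0 ?riesz_kernel_ge0// ltW.
Qed.

End riesz_gauss_sum.

(** * Lower bound on the Lorentz norm *)

(** The level sets are the sections of one measurable subset of the product. *)
Lemma measurable_distribution d (T : measurableType d) (R : realType)
    (mu : {sigma_finite_measure set T -> \bar R}) (g : T -> R) :
  measurable_fun [set: T] g ->
  measurable_fun [set: R] (fun t : R => mu [set x | t < g x]).
Proof.
move=> mg.
pose A : set (measurableTypeR R * T) := (fun z => g z.2 - z.1) @^-1` `]0, +oo[.
have mF : measurable_fun [set: measurableTypeR R * T] (fun z => g z.2 - z.1).
  apply: measurable_funB; last exact: measurable_fst.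
  exact: (measurableT_comp mg measurable_snd).
have mA : measurable A.
  by rewrite -[A]setTI; apply: mF => //; exact: measurable_itv.
have := measurable_fun_xsection mu mA.
apply: eq_measurable_fun => t _ /=; congr (mu _).
apply/seteqP; split => x.
  by move=> /xsectionP; rewrite /A/= in_itv/= andbT subr_gt0.
by move=> tx; apply/xsectionP; rewrite /A/= in_itv/= andbT subr_gt0.
Qed.

(** The [j]-th dyadic interval has half the length of its right end c / 2^j, so each contributes at
    least k / 2. The induction extends the domain to the left, one interval at a time. *)
Lemma integral_geometric_lower (R : realType) (f : R -> \bar R) (c k : R)
    (N : nat) :
  0 < c -> 0 <= k ->
  measurable_fun [set: R] f -> (forall t, 0 < t -> (0 <= f t)%E) ->
  (forall j t, (j < N)%N -> c / 2 ^+ j.+1 <= t < c / 2 ^+ j ->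
     ((k / (c / 2 ^+ j))%:E <= f t)%E) ->
  ((N%:R * (k / 2))%:E <= \int[@lebesgue_measure R]_(t in `]0%R, +oo[) f t)%E.
Proof.
move=> c0 k0 mf f0 fk.
have cp n : 0 < c / 2 ^+ n by rewrite divr_gt0// exprn_gt0.
suff h n : (n <= N)%N -> ((n%:R * (k / 2))%:E <=
    \int[@lebesgue_measure R]_(t in `[(c / 2 ^+ n)%R, c[) f t)%E.
  apply: (le_trans (h N (leqnn _))); apply: ge0_subset_integral.
  - exact: measurable_itv.
  - exact: measurable_itv.
  - exact: measurable_funTS.
  - by move=> t /=; rewrite in_itv/= andbT; exact: f0.
  - by move=> t /=; rewrite !in_itv/= andbT => /andP[+ _]; exact: lt_le_trans.
elim: n => [_|n IH nN].
  rewrite mul0r; apply: integral_ge0 => t /=; rewrite in_itv/= => /andP[ct _].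
  by apply: f0; exact: lt_le_trans ct.
have cS : c / 2 ^+ n.+1 = c / 2 ^+ n / 2.
  by rewrite exprS; field; rewrite expf_neq0.
have cSn : c / 2 ^+ n.+1 <= c / 2 ^+ n.
  by rewrite cS ler_pdivrMr// ler_peMr ?(ltW (cp n))// ler1n.
have cnc : c / 2 ^+ n <= c.
  rewrite ler_pdivrMr ?exprn_gt0// ler_peMr ?(ltW c0)//.
  by rewrite exprn_ege1// ler1n.
rewrite (_ : `[c / 2 ^+ n.+1, c[%classic =
    `[c / 2 ^+ n.+1, c / 2 ^+ n[%classic `|` `[c / 2 ^+ n, c[%classic);
  last first.
  apply/seteqP; split => t /=; rewrite !in_itv/=.
    move=> /andP[t1 t2].
    by have [?|?] := ltP t (c / 2 ^+ n); [left|right]; apply/andP.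
  move=> [/andP[t1 t2]|/andP[t1 t2]]; first by rewrite t1 (lt_le_trans t2).
  by rewrite t2 (le_trans _ t1).
have pos t : c / 2 ^+ n.+1 <= t -> (0 <= f t)%E.
  by move=> /(lt_le_trans (cp _)); exact: f0.
rewrite ge0_integral_setU; last 5 first.
- exact: measurable_itv.
- exact: measurable_itv.
- exact: measurable_funTS.
- move=> t [|] /=; rewrite in_itv/= => /andP[+ _]; first exact: pos.
  by move=> t1; apply: pos; exact: le_trans t1.
- apply/disj_setPS => t /= []; rewrite !in_itv/= => /andP[_ t1] /andP[t2 _].
  by have := lt_le_trans t1 t2; rewrite ltxx.
rewrite -natr1 mulrDl mul1r addrC EFinD; apply: leeD; last exact: IH (ltnW nN).
have len : lebesgue_measure `[c / 2 ^+ n.+1, c / 2 ^+ n[%classic =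
    (c / 2 ^+ n / 2)%:E.
  rewrite lebesgue_measure_itv/= lte_fin.
  have -> : c / 2 ^+ n.+1 < c / 2 ^+ n.
    by rewrite cS ltr_pdivrMr// ltr_pMr// ltr1n.
  by rewrite -EFinB cS; congr _%:E; field; rewrite expf_neq0.
apply: (@le_trans _ _ (\int[@lebesgue_measure R]_(t in
    `[(c / 2 ^+ n.+1)%R, (c / 2 ^+ n)%R[) (k / (c / 2 ^+ n))%:E)%E).
  rewrite integral_cst; last exact: measurable_itv.
  have -> : k / 2 = k / (c / 2 ^+ n) * (c / 2 ^+ n / 2).
    by field; rewrite expf_neq0// gt_eqF.
  by rewrite [X in (_ * X)%E]len -EFinM.
apply: ge0_le_integral.
- exact: measurable_itv.
- by move=> t _; rewrite lee_fin divr_ge0// ltW.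
- exact: measurable_cst.
- exact: measurable_funTS.
- by move=> t /=; rewrite in_itv/=; exact: fk.
Qed.

Section lorentz_lower.
Context {R : realType} {d : nat}.
Variables (alpha r : R) (N : nat).
Hypotheses (hd : (2 <= d)%N) (alpha0 : 0 < alpha) (alphad : alpha < d%:R)
  (r0 : 0 < r).

(* These scales make [dyadic_scale j `^ (d - alpha)] equal to [2 ^+ j]. *)
Definition dyadic_scale (j : nat) : R := 2 `^ (j%:R / (d%:R - alpha)).

Lemma dyadic_scale_gt0 j : 0 < dyadic_scale j. Proof. exact: powR_gt0. Qed.

Let c := riesz_const (d := d) alpha.
Let c0 : 0 < c. Proof. exact: riesz_const_gt0. Qed.
Let u := @gauss_sum_BV R d N dyadic_scale dyadic_scale_gt0.
Let G x := enorm (riesz_potential alpha (bv_grad u) x).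
Let p : R := d%:R / (d%:R - alpha).
Let da0 : 0 < d%:R - alpha. Proof. by rewrite subr_gt0. Qed.
Let d0 : 0 < d%:R :> R. Proof. by rewrite ltr0n (ltn_trans _ hd). Qed.
Let mG : measurable_fun [set: 'rV[R]_d] G.
Proof. exact: measurable_enorm_riesz. Qed.

(** The cube [w_j, 2 w_j]^d has measure w_j^d, whose power 1 / p is w_j^(d - alpha) = 2^j. On it the
    potential is at least c / 2^j, hence above the level [t]. *)
Let distribution_lower j t : (j < N)%N -> t < c / 2 ^+ j ->
  ((2 ^+ j)%:E <= lebesgue_rV R d [set x | (t < G x)%R] `^ p^-1)%E.
Proof.
move=> jN tj.
pose A : set 'rV[R]_d :=
  [set x | forall i, `[dyadic_scale j, 2 * dyadic_scale j]%classic (x ord0 i)].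
have sj := dyadic_scale_gt0 j.
have -> : (2 ^+ j)%:E = (lebesgue_rV R d A `^ p^-1)%E.
  rewrite (@lebesgue_rV_box R d
    (fun=> `[dyadic_scale j, 2 * dyadic_scale j]%classic));
    last by move=> i; exact: measurable_itv.
  rewrite (eq_bigr (fun=> (dyadic_scale j)%:E)); last first.
    move=> i _; rewrite lebesgue_measure_itv/= lte_fin.
    rewrite ltr_pMl// ltr1n -EFinB; congr _%:E; ring.
  rewrite prodEFin prodr_const card_ord poweR_EFin; congr _%:E.
  rewrite -(@powR_mulrn _ (dyadic_scale j)) ?(ltW sj)// /dyadic_scale -!powRrM.
  rewrite -(@powR_mulrn _ 2)//; congr powR.
  by rewrite /p invf_div; field; rewrite !gt_eqF.
apply: gt0_ler_poweR.
- by rewrite invr_ge0 divr_ge0 ?ltW.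
- by rewrite in_itv/= measure_ge0 leey.
- by rewrite in_itv/= measure_ge0 leey.
apply: le_measure.
- rewrite inE.
  apply: (@measurable_box R d
    (fun=> `[dyadic_scale j, 2 * dyadic_scale j]%classic)) => i.
  exact: measurable_itv.
- rewrite inE (_ : [set x | _] = G @^-1` `]t, +oo[%classic).
    by rewrite -[X in measurable X]setTI; exact: mG.
  by apply/seteqP; split => x /=; rewrite in_itv/= andbT.
- move=> x /= xA; apply: (lt_le_trans tj).
  have := enorm_riesz_lower alpha0 alphad dyadic_scale_gt0 (j := Ordinal jN)
    (ltnW hd) xA.
  apply: le_trans; rewrite -/c ler_pM2l// /dyadic_scale -powRrM.
  rewrite (_ : j%:R / _ * _ = - j%:R); last by field; rewrite gt_eqF.
  by rewrite powRN powR_mulrn.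
Qed.

Lemma lorentz_gauss_sum_lower :
  (((p * (N%:R * ((c / 2) `^ r / 2))) `^ r^-1)%R%:E <=
   lorentz_norm p r (riesz_potential alpha (bv_grad u)))%E.
Proof.
have p0 : 0 < p by rewrite divr_gt0.
rewrite -poweR_EFin; apply: gt0_ler_poweR.
- by rewrite invr_ge0 ltW.
- rewrite in_itv/= lee_fin leey andbT mulr_ge0 ?(ltW p0)// mulr_ge0//.
  by rewrite divr_ge0 ?powR_ge0.
- rewrite in_itv/= leey andbT mule_ge0 ?lee_fin ?(ltW p0)//.
  apply: integral_ge0 => t /=; rewrite in_itv/= andbT => t0.
  by rewrite mule_ge0 ?poweR_ge0// lee_fin invr_ge0 ltW.
rewrite EFinM lee_pmul2l//.
apply: (@integral_geometric_lower R _ c) => //.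
- exact: powR_ge0.
- have mdist := measurable_distribution (lebesgue_rV R d) mG.
  have m1 := measurableT_comp (measurable_poweR p^-1) mdist.
  have mid : measurable_fun [set: R] (fun t : R => t%:E).
    by apply/measurable_EFinP; exact: measurable_id.
  have m2 := emeasurable_funM mid m1.
  have m3 := measurableT_comp (measurable_poweR r) m2.
  have m4 : measurable_fun [set: R] (fun t : R => (t^-1)%:E).
    by apply/measurable_EFinP; exact: measurable_invr.
  exact: emeasurable_funM m3 m4.
- by move=> t t0; rewrite mule_ge0 ?poweR_ge0// lee_fin invr_ge0 ltW.
move=> j t jN /andP[t1 t2].
have cj n : 0 < c / 2 ^+ n by rewrite divr_gt0// exprn_gt0.
have t0 : 0 < t := lt_le_trans (cj _) t1.
(* The two ends of the dyadic interval are used separately: t < c / 2^j bounds 1 / t from below, and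
   t >= c / 2^(j+1) gives t * 2^j >= c / 2. *)
rewrite EFinM; apply: lee_pmul;
  rewrite ?lee_fin ?powR_ge0 ?invr_ge0 ?(ltW (cj j))//; last first.
  by rewrite lef_pV2 ?posrE// ltW.
rewrite -poweR_EFin; apply: gt0_ler_poweR.
- exact: ltW.
- by rewrite in_itv/= lee_fin leey andbT divr_ge0// ltW.
- by rewrite in_itv/= leey andbT mule_ge0 ?poweR_ge0// lee_fin ltW.
apply: (@le_trans _ _ (t%:E * (2 ^+ j)%:E)%E).
  rewrite -EFinM lee_fin -ler_pdivrMr ?exprn_gt0//.
  by rewrite (le_trans _ t1)// exprS invfM mulrA.
by rewrite lee_pmul2l//; exact: distribution_lower.
Qed.

End lorentz_lower.

Theorem corollary4p4 (R : realType) (d : nat) (alpha : R)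
    (hd : (2 <= d)%N) (halpha0 : 0 < alpha) (halphad : alpha < d%:R)
    (r : R) (hr0 : 0 < r) (hr1 : r < 1) (M : nat) :
  exists u : BV R d,
    (M%:R%:E * vtotal_variation (bv_grad u) <
     lorentz_norm (d%:R / (d%:R - alpha)) r
       (riesz_potential alpha (bv_grad u)))%E.
Proof.
pose p : R := d%:R / (d%:R - alpha).
pose k : R := (riesz_const (d := d) alpha / 2) `^ r / 2.
have p0 : 0 < p by rewrite divr_gt0 ?subr_gt0// ltr0n (ltn_trans _ hd).
have k0 : 0 < k by rewrite divr_gt0// powR_gt0// divr_gt0// riesz_const_gt0.
have e0 : 0 < r^-1 - 1 by rewrite subr_gt0 invf_gt1.
(* The goal is M * 3 d N < (p k N)^(1/r). Dividing by N and by (p k)^(1/r) turns it into X < N^(1/r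
   - 1), whose exponent is positive because [r < 1]. *)
pose X : R := M%:R * (3 * d%:R) / (p * k) `^ r^-1.
pose N := (Num.truncn (X `^ (r^-1 - 1)^-1)).+1.
have X0 : 0 <= X by rewrite !(mulr_ge0, invr_ge0) ?powR_ge0.
have XN : X < N%:R `^ (r^-1 - 1).
  have XE : X = (X `^ (r^-1 - 1)^-1) `^ (r^-1 - 1).
    by rewrite -powRrM mulVf ?gt_eqF// powRr1.
  rewrite [ltLHS]XE; apply: gt0_ltr_powR; rewrite ?nnegrE ?powR_ge0//.
  exact: truncnS_gt.
exists (@gauss_sum_BV R d N _ (@dyadic_scale_gt0 R d alpha)).

apply: (lt_le_trans _ (lorentz_gauss_sum_lower N hd halpha0 halphad hr0)).
apply: (@le_lt_trans _ _ (M%:R * (3 * d%:R * N%:R))%:E).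
  by rewrite EFinM lee_wpmul2l ?lee_fin//; exact: vtotal_variation_gauss_sum.
rewrite lte_fin -/p -/k [p * _]mulrCA.
have N0 : 0 < N%:R :> R by rewrite ltr0n.
have pk0 : 0 < p * k by rewrite mulr_gt0.
have -> : (N%:R * (p * k)) `^ r^-1 =
    N%:R `^ (r^-1 - 1) * (p * k) `^ r^-1 * N%:R.
  rewrite powRM ?(ltW N0) ?(ltW pk0)// powRB1// [RHS]mulrAC divfK//.
  by rewrite gt_eqF.
by rewrite mulrA ltr_pM2r// -ltr_pdivrMr ?powR_gt0.
Qed.
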